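(* Let $N\ge 2$, let $\Omega\subset\mathbb{R}^N$ be a bounded open set, $p\in(1,\infty)$, $p'=\frac p{p-1}$, $0<\alpha<\beta$, $c=\big(\frac\beta\alpha\big)^{\frac1{p-1}}-1>0$, $0<\kappa<|\Omega|$ and $f\in W^{-1,p'}(\Omega)$. Consider the problem $$(\mathrm{R})\qquad \min\left\{\frac1p\int_\Omega\frac{|\nabla u|^p}{(1+c\,\theta)^{p-1}}\,dx-\langle f,u\rangle:\ u\in W^{1,p}_0(\Omega),\ \theta\in L^\infty(\Omega;[0,1]),\ \int_\Omega\theta\,dx\le\kappa\right\}.$$ A pair $(\hat u,\hat\theta)\in W^{1,p}_0(\Omega)\times L^\infty(\Omega;[0,1])$ is a solution of (R) if and only if there exists $\hat\mu\ge0$ such that $\hat u$ is a solution of $$\min_{u\in W^{1,p}_0(\Omega)}\left(\int_\Omega F(|\nabla u|)\,dx-\langle f,u\rangle\right),$$ where $F\in C^1([0,\infty))\cap W^{2,\infty}_{loc}(0,\infty)$ is the convex function defined by $$F(0)=0,\qquad F'(s)=\begin{cases} s^{p-1} & \text{if } 0\le s<\hat\mu,\\ \hat\mu^{p-1} & \text{if } \hat\mu\le s\le(1+c)\hat\mu,\\ \dfrac{s^{p-1}}{(1+c)^{p-1}} & \text{if } s>(1+c)\hat\mu,\end{cases}$$ and $\hat\mu$, $\hat\theta$ are related as follows: - if $\hat\mu=0$, then $\hat\theta=1$ a.e. in $\{|\nabla\hat u|>0\}$ and $\int_\Omega\hat\theta\,dx\le\kappa$; - if $\hat\mu>0$, then,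 a.e. in $\Omega$, $$\hat\theta=\begin{cases}0&\text{if } 0\le|\nabla\hat u|<\hat\mu,\\ \dfrac1c\Big(\dfrac{|\nabla\hat u|}{\hat\mu}-1\Big)&\text{if }\hat\mu\le|\nabla\hat u|\le(1+c)\hat\mu,\\ 1&\text{if }|\nabla\hat u|>(1+c)\hat\mu,\end{cases}\qquad\text{and}\qquad \int_\Omega\hat\theta\,dx=\kappa.$$
   Context: $\langle f,u\rangle$ is the duality pairing between $W^{-1,p'}(\Omega)$ and $W^{1,p}_0(\Omega)$; $L^\infty(\Omega;[0,1])$ is the set of measurable functions with values in $[0,1]$ a.e. *)

(* Defs.v *)
From HB Require Import structures.
From mathcomp Require Import all_boot all_order all_algebra.
From mathcomp Require Import all_classical all_reals all_analysis.

Set Implicit Arguments.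
Unset Strict Implicit.
Unset Printing Implicit Defensive.

Import Order.TTheory GRing.Theory Num.Theory.
Import numFieldNormedType.Exports.

Local Open Scope classical_set_scope.
Local Open Scope ring_scope.

(* R^n is 'rV[R]_n.  Its sigma-algebra is the product of the Borel
   sigma-algebras of the coordinates, that is the Borel sigma-algebra of R^n.
   Lebesgue measurable functions and Borel functions have the same classes
   modulo equality almost everywhere. *)

Definition rV_display : measure_display.
Proof. exact: default_measure_display. Qed.

Section rV_measurable.
Context {R : realType} (n : nat).

Let coors : 'I_n -> 'rV[R]_n -> measurableTypeR R := fun i x => x ord0 i.

Let rV_set0 : g_sigma_preimage coors set0.
Proof. exact: sigma_algebra0. Qed.

Let rV_setC A : g_sigma_preimage coors A -> g_sigma_preimage coors (~` A).
Proof. exact: sigma_algebraC. Qed.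

Let rV_bigcup (F : (set 'rV[R]_n)^nat) : (forall i, g_sigma_preimage coors (F i)) ->
  g_sigma_preimage coors (\bigcup_i (F i)).
Proof. exact: sigma_algebra_bigcup. Qed.

HB.instance Definition _ := @isMeasurable.Build rV_display
  'rV[R]_n (g_sigma_preimage coors) rV_set0 rV_setC rV_bigcup.

End rV_measurable.

Section rV_measurable_lemmas.
Context {R : realType}.

Lemma measurable_coor n (i : 'I_n) :
  measurable_fun [set: 'rV[R]_n] (fun x => x ord0 i : measurableTypeR R).
Proof.
move=> _ Y mY; rewrite setTI; apply: sub_sigma_algebra => /=.
rewrite -bigcup_seq/=; exists i => /=; first by rewrite mem_index_enum.
by exists Y => //; rewrite setTI.
Qed.

Lemma measurable_fun_coorP d (T : measurableType d) n (f : T -> 'rV[R]_n) :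
  (forall i, measurable_fun [set: T] (fun x => f x ord0 i : measurableTypeR R)) ->
  measurable_fun [set: T] f.
Proof.
move=> mf _ A mA.
have : g_sigma_preimage (fun i x => f x ord0 i : measurableTypeR R) (f @^-1` A).
  rewrite (_ : (fun i x => _) = fun i => (fun x : 'rV[R]_n => x ord0 i) \o f)//.
  by rewrite g_sigma_preimage_comp; exists A => //; rewrite setTI.
rewrite setTI; apply: smallest_sub; first exact: sigma_algebra_measurable.
case: n f mf A mA => [|n] f mf A mA; first by rewrite big_ord0.
rewrite -bigcup_mkord_ord; apply: bigcup_sub => i Ii.
by move=> B [C mC <-]; exact: mf.
Qed.

Definition rV_cons n (x : measurableTypeR R * 'rV[R]_n) : 'rV[R]_n.+1 :=
  row_mx (const_mx x.1 : 'rV[R]_1) x.2.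

Definition rV_uncons n (x : 'rV[R]_n.+1) : measurableTypeR R * 'rV[R]_n :=
  (x ord0 ord0, \row_i x ord0 (lift ord0 i)).

Lemma rV_unconsK n : cancel (@rV_uncons n) (@rV_cons n).
Proof.
move=> x; apply/rowP => j; rewrite /rV_cons mxE.
case: splitP => k jk; rewrite !mxE /=; congr (x _ _); apply: val_inj => //=.
by rewrite jk ord1.
Qed.

Lemma rV_consK n : cancel (@rV_cons n) (@rV_uncons n).
Proof.
move=> [x y]; rewrite /rV_cons /rV_uncons; congr (_, _).
  by rewrite mxE; case: splitP => k //= _; rewrite mxE.
apply/rowP => j; rewrite !mxE.
case: splitP => k /=; first by rewrite [k]ord1.
by rewrite /bump /= => -[jk]; congr (y _ _); apply: val_inj.
Qed.

Lemma measurable_rV_cons n : measurable_fun setT (@rV_cons n).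
Proof.
apply: measurable_fun_coorP => i.
have [j ->|->] := unliftP ord0 i.
  have -> : (fun x => rV_cons x ord0 (lift ord0 j)) =
      (fun y : 'rV[R]_n => y ord0 j : measurableTypeR R) \o snd.
    by apply/funext => x; rewrite /= -[in RHS](rV_consK x) /= mxE.
  by apply: measurableT_comp => //; exact: measurable_coor.
have -> : (fun x => rV_cons x ord0 ord0 : measurableTypeR R) = @fst _ 'rV[R]_n.
  by apply/funext => x; rewrite -[in RHS](rV_consK x).
exact: measurable_fst.
Qed.

Lemma measurable_rV_uncons n : measurable_fun setT (@rV_uncons n).
Proof.
apply: measurable_fun_pair; first exact: measurable_coor.
apply: measurable_fun_coorP => i.
rewrite (_ : (fun x => _) = fun x : 'rV[R]_n.+1 => x ord0 (lift ord0 i)).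
  exact: measurable_coor.
by apply/funext => x; rewrite mxE.
Qed.

HB.instance Definition _ n :=
  @isMeasurableFun.Build _ _ _ _ (@rV_cons n) (@measurable_rV_cons n).

End rV_measurable_lemmas.

Section rV_lebesgue.
Context {R : realType}.
Local Open Scope ereal_scope.

Section step.
Context (n : nat) (mu : {sigma_finite_measure set 'rV[R]_n -> \bar R}).

Definition lebesgue_rVS : set 'rV[R]_n.+1 -> \bar R :=
  pushforward (@lebesgue_measure R \x mu) (@rV_cons R n).

Let lebesgue_rVS0 : lebesgue_rVS set0 = 0.
Proof. exact: measure0. Qed.

Let lebesgue_rVS_ge0 A : 0 <= lebesgue_rVS A.
Proof. exact: measure_ge0. Qed.

Let lebesgue_rVS_sigma_additive : semi_sigma_additive lebesgue_rVS.
Proof. exact: measure_semi_sigma_additive. Qed.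

HB.instance Definition _ := isMeasure.Build _ _ _ lebesgue_rVS
  lebesgue_rVS0 lebesgue_rVS_ge0 lebesgue_rVS_sigma_additive.

Let lebesgue_rVS_sigma_finite : sigma_finite setT lebesgue_rVS.
Proof.
have /sigma_finiteP[F [TF ndF Foo]] := sigma_finiteT (@lebesgue_measure R).
have /sigma_finiteP[G [TG ndG Goo]] := sigma_finiteT mu.
exists (fun k => @rV_uncons R n @^-1` (F k `*` G k)).
  rewrite -preimage_bigcup (_ : \bigcup_k _ = setT) ?preimage_setT//.
  apply/seteqP; split=> // -[x y] _.
  have [i _ Fix] : (\bigcup_k F k) x by rewrite -TF.
  have [j _ Gjy] : (\bigcup_k G k) y by rewrite -TG.
  exists (maxn i j) => //; split.
    by move: x Fix; exact/subsetPset/ndF/leq_maxl.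
  by move: y Gjy; exact/subsetPset/ndG/leq_maxr.
move=> k; have [mF Fk] := Foo k; have [mG Gk] := Goo k; split.
  rewrite -[X in measurable X]setTI; apply: measurable_rV_uncons => //.
  exact: measurableX.
rewrite /lebesgue_rVS /pushforward -comp_preimage (_ : _ \o _ = id).
  by rewrite preimage_id product_measure1E// lte_mul_pinfty// ge0_fin_numE.
by apply/funext => x /=; rewrite rV_consK.
Qed.

HB.instance Definition _ := Measure_isSigmaFinite.Build _ _ _
  lebesgue_rVS lebesgue_rVS_sigma_finite.

End step.

(* Lebesgue measure on R^n *)
Fixpoint lebesgue_rV n : {sigma_finite_measure set 'rV[R]_n -> \bar R} :=
  match n return {sigma_finite_measure set 'rV[R]_n -> \bar R} with
  | 0%N => dirac (0 : 'rV[R]_0)%R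
  | m.+1 => lebesgue_rVS (lebesgue_rV m)
  end.

End rV_lebesgue.

Lemma lebesgue_rV_box (R : realType) n (a b : 'rV[R]_n) :
  (forall i, a ord0 i <= b ord0 i) ->
  lebesgue_rV n
    [set x : 'rV[R]_n | forall i, a ord0 i <= x ord0 i <= b ord0 i] =
  (\prod_i (b ord0 i - a ord0 i))%:E.
Proof.
elim: n a b => [|n IH] a b ab.
  rewrite big_ord0 /= diracE mem_set//= => -[]//.
set B := (X in lebesgue_rV n.+1 X).
pose a' : 'rV[R]_n := \row_i a ord0 (lift ord0 i); pose b' : 'rV[R]_n := \row_i b ord0 (lift ord0 i).
have -> : lebesgue_rV n.+1 B = (@lebesgue_measure R \x lebesgue_rV n)%E
    (`[a ord0 ord0, b ord0 ord0]%classic `*`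
    [set x : 'rV[R]_n | forall i, a' ord0 i <= x ord0 i <= b' ord0 i]).
  rewrite /= /lebesgue_rVS /pushforward; congr (_ _).
  have E0 x y : @rV_cons R n (x, y) ord0 ord0 = x.
    by have := rV_consK (x, y); rewrite /rV_uncons => -[].
  have ES x y i : @rV_cons R n (x, y) ord0 (lift ord0 i) = y ord0 i.
    by have := rV_consK (x, y); rewrite /rV_uncons => -[_ /rowP /(_ i)];
      rewrite mxE.
  apply/seteqP; split => -[x y] /=.
    move=> H; split; rewrite /= ?in_itv /=; first by have := H ord0; rewrite E0.
    by move=> i; have := H (lift ord0 i); rewrite ES /a' /b' !mxE.
  move=> [] /=; rewrite in_itv /= => H1 H2 i.
  by have [j ->|->] := unliftP ord0 i; rewrite ?E0// ES; have := H2 j; rewrite !mxE.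
rewrite product_measure1E//=; last first.
  rewrite (_ : [set x : 'rV[R]_n | forall i, a' ord0 i <= x ord0 i <= b' ord0 i] =
    \bigcap_(i in [set: 'I_n]) ((fun x : 'rV[R]_n => x ord0 i : measurableTypeR R)
      @^-1` `[a' ord0 i, b' ord0 i]%classic)).
    apply: fin_bigcap_measurable => // i _; rewrite -[X in measurable X]setTI.
    exact: measurable_coor.
  apply/seteqP; split => x /=.
    by move=> H i _ /=; rewrite in_itv /= H.
  by move=> H i; have := H i I; rewrite /= in_itv.
rewrite IH; last by move=> i; rewrite !mxE.
rewrite lebesgue_measure_itv/= lte_fin big_ord_recl EFinM.
have -> : (\prod_(i < n) (b' ord0 i - a' ord0 i)) =
    \prod_(i < n) (b ord0 (lift ord0 i) - a ord0 (lift ord0 i)).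
  by apply: eq_bigr => i _; rewrite !mxE.
case: ltP => [_|h]; first by rewrite -EFinB.
have -> : b ord0 ord0 = a ord0 ord0 by apply/eqP; rewrite eq_le h ab.
by rewrite subrr.
Qed.

Section sobolev.
Context {R : realType} {N : nat}.
Implicit Types (Om : set 'rV[R]_N) (p : R).

(* The norm of the normed module 'rV[R]_N is the max norm. *)
Definition enorm (v : 'rV[R]_N) : R := Num.sqrt (\sum_i v ord0 i ^+ 2).

Definition partial (i : 'I_N) (phi : 'rV[R]_N -> R^o) : 'rV[R]_N -> R^o :=
  fun x => 'D_(delta_mx ord0 i) phi x.

Definition gradient (phi : 'rV[R]_N -> R^o) : 'rV[R]_N -> 'rV[R]_N :=
  fun x => \row_i partial i phi x.

(* class C^oo: partial derivatives of all orders exist and are continuous *)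
Definition smooth (phi : 'rV[R]_N -> R^o) : Prop :=
  forall s : seq 'I_N, let psi := foldr partial phi s in
    continuous psi /\ forall i x, derivable psi x (delta_mx ord0 i).

(* C_c^oo(Om) *)
Definition test_function Om (phi : 'rV[R]_N -> R^o) : Prop :=
  smooth phi /\
  exists K, [/\ compact K, K `<=` Om & forall x, ~ K x -> phi x = 0].

Definition weak_gradient Om (u : 'rV[R]_N -> R) (G : 'rV[R]_N -> 'rV[R]_N) :=
  forall (phi : 'rV[R]_N -> R^o) (i : 'I_N), test_function Om phi ->
    \int[lebesgue_rV N]_(x in Om) (u x * partial i phi x) =
    - \int[lebesgue_rV N]_(x in Om) (G x ord0 i * phi x).

(* A Sobolev function is carried with its weak gradient, as a pair (u, grad u);
   the second component is determined by the first almost everywhere. *)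
Definition wfun : lmodType R :=
  (('rV[R]_N -> R^o) * ('rV[R]_N -> 'rV[R]_N))%type.

Definition W1p Om p : set wfun := [set u |
  [/\ measurable_fun Om (u.1 : 'rV[R]_N -> measurableTypeR R),
      measurable_fun Om u.2,
      (\int[lebesgue_rV N]_(x in Om) (`|u.1 x| `^ p)%:E < +oo)%E,
      (\int[lebesgue_rV N]_(x in Om) (enorm (u.2 x) `^ p)%:E < +oo)%E &
      weak_gradient Om u.1 u.2]].

Definition W1p_norm Om p (u : wfun) : \bar R :=
  ((\int[lebesgue_rV N]_(x in Om) (`|u.1 x| `^ p)%:E +
    \int[lebesgue_rV N]_(x in Om) (enorm (u.2 x) `^ p)%:E) `^ p^-1)%E.

(* W^{1,p}_0(Om): closure of C_c^oo(Om) in W^{1,p}(Om) *)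
Definition W1p0 Om p : set wfun := [set u | W1p Om p u /\
  exists phi : nat -> 'rV[R]_N -> R^o,
    (forall k, test_function Om (phi k)) /\
    W1p_norm Om p (u - ((phi k, gradient (phi k)) : wfun)) @[k --> \oo]
      --> 0%E].

(* W^{-1,p'}(Om): bounded linear functionals on W^{1,p}_0(Om).  The values of f
   outside W^{1,p}_0(Om) are irrelevant; boundedness makes f u depend only on
   the class of u modulo equality almost everywhere in Om. *)
Definition W1p0_dual Om p : set (wfun -> R) := [set f |
  (forall (a : R) (u v : wfun), W1p0 Om p u -> W1p0 Om p v ->
     f (a *: u + v) = a * f u + f v) /\
  exists C : R, forall u, W1p0 Om p u ->
     (`|f u|%:E <= C%:E * W1p_norm Om p u)%E].

(* L^oo(Om; [0, 1]) *)
Definition Loo01 Om : set ('rV[R]_N -> R) := [set theta |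
  measurable_fun Om (theta : 'rV[R]_N -> measurableTypeR R) /\
  {ae lebesgue_rV N, forall x, Om x -> 0 <= theta x <= 1}].

End sobolev.
Arguments wfun : clear implicits.

Definition is_minimizer (R : realType) (T : Type) (A : set T) (J : T -> \bar R)
    (x : T) : Prop :=
  A x /\ forall y, A y -> (J x <= J y)%E.

Section problems.
Context {R : realType} {N : nat}.
Implicit Types (Om : set 'rV[R]_N) (p c kappa : R) (f : wfun R N -> R).

Definition R_admissible Om p kappa : set (wfun R N * ('rV[R]_N -> R)) :=
  [set ut | [/\ W1p0 Om p ut.1, Loo01 Om ut.2 &
    (\int[lebesgue_rV N]_(x in Om) (ut.2 x)%:E <= kappa%:E)%E]].

Definition R_energy Om p c f (ut : wfun R N * ('rV[R]_N -> R)) : \bar R :=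
  ((p^-1)%:E * \int[lebesgue_rV N]_(x in Om)
     (enorm (ut.1.2 x) `^ p / (1 + c * ut.2 x) `^ (p - 1))%:E
   - (f ut.1)%:E)%E.

Definition R_solution Om p c kappa f u theta : Prop :=
  is_minimizer (R_admissible Om p kappa) (R_energy Om p c f) (u, theta).

Definition F_energy Om f (F : R -> R) (u : wfun R N) : \bar R :=
  (\int[lebesgue_rV N]_(x in Om) (F (enorm (u.2 x)))%:E - (f u)%:E)%E.

End problems.

Section integrand.
Context {R : realType}.
Implicit Types (p c mu s : R).

Definition dFmu p c mu s : R :=
  if s < mu then s `^ (p - 1)
  else if s <= (1 + c) * mu then mu `^ (p - 1)
  else s `^ (p - 1) / (1 + c) `^ (p - 1).

(* The function with F(0) = 0 and F' = dFmu; its regularity and convexity, and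
   the fact that dFmu is its derivative, are part of the theorem. *)
Definition Fmu p c mu s : R := \int[lebesgue_measure]_(t in `[0, s]) dFmu p c mu t.

(* the value of theta at a point where |grad u| = s, when 0 < mu *)
Definition theta_of c mu s : R :=
  if s < mu then 0
  else if s <= (1 + c) * mu then c^-1 * (s / mu - 1)
  else 1.

(* g is the derivative of h on [0, +oo[, one-sided at 0, and is continuous *)
Definition C1_halfline (h g : R -> R) : Prop :=
  [/\ {within `[0, +oo[%classic, continuous g},
      forall s : R, 0 < s -> is_derive (s : R^o) 1 (h : R^o -> R^o) (g s) &
      (fun t : R => t^-1 * (h t - h 0)) @ 0^'+ --> g 0].

(* C_c^oo(]0, +oo[) *)
Definition test_function_pos (phi : R -> R) : Prop :=
  (forall n (x : R), derivable (derive1n n (phi : R^o -> R^o)) x 1) /\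
  exists a b : R, 0 < a /\ forall x, ~~ (a <= x <= b) -> phi x = 0.

Definition weak_derive_pos (h g : R -> R) : Prop :=
  forall phi, test_function_pos phi ->
    \int[lebesgue_measure]_(x in `]0, +oo[) (h x * derive1 (phi : R^o -> R^o) x) =
    - \int[lebesgue_measure]_(x in `]0, +oo[) (g x * phi x).

Definition Loo_loc_pos (g : R -> R) : Prop :=
  measurable_fun (`]0, +oo[%classic : set (measurableTypeR R))
    (g : measurableTypeR R -> measurableTypeR R) /\
  forall a b : R, 0 < a -> exists M : R,
    {ae lebesgue_measure, forall x, a <= x <= b -> `|g x| <= M}.

(* W^{2,oo}_loc(]0, +oo[) *)
Definition W2oo_loc_pos (h : R -> R) : Prop :=
  exists h1 h2, [/\ Loo_loc_pos h, Loo_loc_pos h1, Loo_loc_pos h2,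
    weak_derive_pos h h1 & weak_derive_pos h1 h2].

End integrand.

(* Main.v *)
Require Import Defs.
From HB Require Import structures.
From mathcomp Require Import all_boot all_order all_algebra.
From mathcomp Require Import all_classical all_reals all_analysis.
From mathcomp Require Import measurable_realfun ring lra.

Set Implicit Arguments.
Unset Strict Implicit.
Unset Printing Implicit Defensive.

Import Order.TTheory GRing.Theory Num.Theory.
Import numFieldNormedType.Exports.

Local Open Scope classical_set_scope.
Local Open Scope ring_scope.

(** Fix a threshold [mu >= 0] and charge the price
    [multiplier p c mu = c * (p - 1) / p * mu^p] per unit of volume fraction.  At a point
    where the gradient has length [s], the integrand of the relaxed problem plus
    this price is
    [lagrangian s t = p^-1 * s^p / (1 + c * t)^(p-1) + multiplier * t].
    Its minimum over [t] in [[0, 1]] is [Fmu s], attained exactly at the fraction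
    given by [theta_of] (and, for [mu = 0] and [s > 0], exactly at 1).  The
    theorem is thus Lagrangian duality for the constraint on the volume.

    The pointwise part rests on Young's inequality, which exhibits
    [s^p / y^(p-1)] as a supremum of affine functions of [(s, y)]
    ([persp_ge]).  The affine function that touches at the optimal fraction gives
    in one stroke ([Fmin_tangent]) the optimality of this fraction and the fact
    that [dFmu] is a subgradient of the minimum.  A function with a continuous
    subgradient is convex and of class C^1, and is the integral of the
    subgradient; hence the minimum is [Fmu] ([FmuE]), and convexity and C^1
    regularity follow at once.  The second weak derivative is obtained by
    integration by parts on the three branches of [dFmu].

    If [mu], [u] and [theta] are as in the theorem, then [theta] attains the
    pointwise minimum and the term [multiplier * (int theta - kappa)] vanishes.
    Integrating [lagrangian >= Fmu] for an arbitrary admissible pair and using that [u]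
    minimizes the energy of [Fmu] shows that [(u, theta)] is a solution.

    For the other direction, the supremum above also shows that the integrand is
    jointly convex in the gradient and the fraction, so that the relaxed problem
    is convex, with the strictly admissible fraction 0.  Its solutions
    therefore have a Lagrange multiplier ([convex_multiplier]), which is
    [multiplier p c mu] for some [mu].  Minimizing the Lagrangian first over the
    fraction gives the problem for [Fmu] and the formula for [theta]
    ([relaxed_solution_iff]).  This uses that [W1p0] is convex, which comes from
    the integrability of Sobolev functions on a bounded open set. *)

(** * The perspective of a power *)

Section perspective.
Context {R : realType}.
Implicit Types p s a y : R.

Lemma le_of_eq (x y : R) : x = y -> x <= y.
Proof. by move=> ->. Qed.

(** Strict Young inequality, that is, the graph of the power lies above its
    tangent at [a].  With [x = a * exp z] and after division by [a^p * exp z] it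
    reads [exp ((p - 1) z) + (p - 1) exp (- z) > p], which is the sum of two
    instances of [exp y > 1 + y]. *)
Lemma powR_young_lt p x a : 1 < p -> 0 <= x -> 0 < a -> x != a ->
  p * a `^ (p - 1) * x - (p - 1) * a `^ p < x `^ p.
Proof.
move=> p1 x0 a0 xa.
have p0 : 0 < p by lra.
have p10 : 0 < p - 1 by lra.
move: x0; rewrite le_eqVlt => /predU1P[<-|x0].
  rewrite mulr0 sub0r powR0 ?gt_eqF// oppr_lt0 mulr_gt0// powR_gt0//.
set z := ln (x / a).
have xaE : x = a * expR z by rewrite lnK ?posrE ?divr_gt0// mulrCA divff ?mulr1// gt_eqF.
have z0 : z != 0.
  apply: contra xa => /eqP z0.
  by rewrite xaE z0 expR0 mulr1.
have e1 : 1 + (p - 1) * z < expR ((p - 1) * z).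
  by apply: expR_gt1Dx; rewrite mulf_neq0// gt_eqF.
have e2 : 1 - z < expR (- z) by apply: expR_gt1Dx; rewrite oppr_eq0.
have -> : x `^ p = a `^ p * expR z * expR ((p - 1) * z).
  rewrite xaE powRM ?expR_ge0 ?ltW// -mulrA -expRD; congr (_ * _).
  by rewrite /powR gt_eqF ?expR_gt0// expRK; congr expR; ring.
have -> : p * a `^ (p - 1) * x = p * a `^ p * expR z.
  by rewrite -(@mulr_powRB1 _ a p (ltW a0) p0) xaE; ring.
have e3 : (p - 1) * expR z * (1 - z) < p - 1.
  rewrite -mulrA -subr_gt0 -{1}[p - 1]mulr1 -mulrBr mulr_gt0// subr_gt0.
  by rewrite -[ltRHS](expRxMexpNx_1 z) ltr_pM2l ?expR_gt0.
have e4 : expR z * (1 + (p - 1) * z) < expR z * expR ((p - 1) * z).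
  by rewrite ltr_pM2l ?expR_gt0.
have ap : 0 < a `^ p by rewrite powR_gt0.
rewrite -mulrA [p * _]mulrC -!mulrA [(p - 1) * _]mulrC -mulrBr ltr_pM2l//.
move: e3 e4; set u := expR z; set w := expR _; nra.
Qed.

Lemma powR_young p x a : 1 < p -> 0 <= x -> 0 <= a ->
  p * a `^ (p - 1) * x - (p - 1) * a `^ p <= x `^ p.
Proof.
move=> p1 x0; rewrite le_eqVlt => /predU1P[<-|a0].
  by rewrite !powR0 ?subr_eq0 ?gt_eqF ?mulr0 ?mul0r ?subrr ?powR_ge0//; lra.
have [->|xa] := eqVneq x a; last exact/ltW/powR_young_lt.
have p0 : 0 < p by lra.
by apply: le_of_eq; rewrite -(@mulr_powRB1 _ a p (ltW a0) p0); ring.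
Qed.

(** The perspective form [y * (s / y)^p] turns inequalities for the power into
    inequalities for [s^p / y^(p-1)]. *)
Lemma perspE p s y : 1 < p -> 0 <= s -> 0 < y ->
  s `^ p / y `^ (p - 1) = y * (s / y) `^ p.
Proof.
move=> p1 s0 y0.
have p0 : 0 < p by lra.
have -> : (s / y) `^ p = s `^ p / y `^ p.
  rewrite powRM ?invr_ge0 ?(ltW y0)//; congr (_ * _).
  by rewrite -[in LHS]powR_inv1 ?(ltW y0)// -powRrM mulN1r powRN.
rewrite -(mulr_powRB1 (ltW y0) p0); field.
by rewrite !gt_eqF ?powR_gt0.
Qed.

(** These affine minorants touch at [a = s / y], so that [s^p / y^(p-1)] is a
    supremum of affine functions of [(s, y)]; everything convex in the sequel
    rests on this. *)
Lemma persp_ge p s y a : 1 < p -> 0 <= s -> 0 < y -> 0 <= a ->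
  p * a `^ (p - 1) * s - (p - 1) * a `^ p * y <= s `^ p / y `^ (p - 1).
Proof.
move=> p1 s0 y0 a0; rewrite perspE//.
have := @powR_young p (s / y) a p1 (divr_ge0 s0 (ltW y0)) a0.
rewrite -(ler_pM2l y0); apply: le_trans.
by apply: le_of_eq; field; rewrite gt_eqF.
Qed.

Lemma persp_gt p s y a : 1 < p -> 0 <= s -> 0 < y -> 0 < a -> s != a * y ->
  p * a `^ (p - 1) * s - (p - 1) * a `^ p * y < s `^ p / y `^ (p - 1).
Proof.
move=> p1 s0 y0 a0 say; rewrite perspE//.
have sya : s / y != a by rewrite -(inj_eq (mulIf (lt0r_neq0 y0))) divfK// gt_eqF.
have := @powR_young_lt p (s / y) a p1 (divr_ge0 s0 (ltW y0)) a0 sya.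
rewrite -(ltr_pM2l y0); apply: le_lt_trans.
by apply: le_of_eq; field; rewrite gt_eqF.
Qed.

(** Joint convexity: add up, with weights [t] and [1 - t], the minorants that
    touch at the convex combination. *)
Lemma persp_convex p t s1 s2 y1 y2 : 1 < p -> 0 <= t <= 1 ->
  0 <= s1 -> 0 <= s2 -> 0 < y1 -> 0 < y2 ->
  (t * s1 + (1 - t) * s2) `^ p / (t * y1 + (1 - t) * y2) `^ (p - 1) <=
  t * (s1 `^ p / y1 `^ (p - 1)) + (1 - t) * (s2 `^ p / y2 `^ (p - 1)).
Proof.
move=> p1 /andP[t0 t1] s10 s20 y10 y20.
set s := t * s1 + _; set y := t * y1 + _.
have s0 : 0 <= s by rewrite addr_ge0// mulr_ge0// subr_ge0.
have y0 : 0 < y.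
  rewrite /y; move: t0; rewrite le_eqVlt => /predU1P[<-|t0]; first lra.
  by rewrite ltr_pwDl ?mulr_gt0// mulr_ge0 ?subr_ge0// ltW.
set a := s / y.
have a0 : 0 <= a by rewrite divr_ge0// ltW.
have e : s `^ p / y `^ (p - 1) = p * a `^ (p - 1) * s - (p - 1) * a `^ p * y.
  rewrite perspE// -/a.
  have -> : s = a * y by rewrite divfK ?gt_eqF.
  rewrite -(@mulr_powRB1 _ a p)//; [ring|lra].
have h1 := persp_ge p1 s10 y10 a0; have h2 := persp_ge p1 s20 y20 a0.
rewrite e.
have t1' : 0 <= 1 - t by lra.
apply: (le_trans _ (lerD (ler_wpM2l t0 h1) (ler_wpM2l t1' h2))).
by apply: le_of_eq; rewrite /s /y; ring.
Qed.

End perspective.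

(** * The pointwise Lagrangian and its minimum over the volume fraction *)

Section relaxed_integrand.
Context {R : realType}.
Implicit Types p c mu s t : R.

(** For [mu = 0] the multiplier vanishes and the full fraction 1 is optimal; the
    formula for [theta_of] only makes sense for positive [mu]. *)
Definition opt_frac c mu s : R := if mu == 0 then 1 else theta_of c mu s.

(** The quotient [s / (1 + c * opt_frac c mu s)]: the point at which the affine
    minorant of the perspective touches at the optimal fraction. *)
Definition tangency c mu s : R :=
  if s < mu then s else if s <= (1 + c) * mu then mu else s / (1 + c).

(** The multiplier of the volume constraint for which the derivative in [t] of
    the Lagrangian vanishes exactly where [s / (1 + c * t)] equals [mu]. *)
Definition multiplier p c mu : R := c * ((p - 1) / p) * mu `^ p.

Definition lagrangian p c mu s t : R :=
  p^-1 * (s `^ p / (1 + c * t) `^ (p - 1)) + multiplier p c mu * t.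

Definition Fmin p c mu s : R := lagrangian p c mu s (opt_frac c mu s).

Lemma multiplier_ge0 p c mu : 1 < p -> 0 < c -> 0 <= multiplier p c mu.
Proof.
by move=> p1 c0; rewrite !mulr_ge0 ?powR_ge0 ?invr_ge0 ?(ltW c0)//; lra.
Qed.

Lemma multiplier_gt0 p c mu : 1 < p -> 0 < c -> 0 < mu -> 0 < multiplier p c mu.
Proof.
by move=> p1 c0 mu0; rewrite mulr_gt0 ?powR_gt0// mulr_gt0// divr_gt0//; lra.
Qed.

Lemma multiplier0 p c : 1 < p -> multiplier p c 0 = 0.
Proof. by move=> p1; rewrite /multiplier powR0 ?mulr0// gt_eqF//; lra. Qed.

Lemma multiplier_surj p c l : 1 < p -> 0 < c -> 0 <= l ->
  exists2 mu, 0 <= mu & multiplier p c mu = l.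
Proof.
move=> p1 c0 l0; exists ((l / (c * ((p - 1) / p))) `^ p^-1); first exact: powR_ge0.
have k0 : 0 < c * ((p - 1) / p) by rewrite mulr_gt0// divr_gt0//; lra.
rewrite /multiplier -powRrM mulVf ?gt_eqF//; last lra.
by rewrite powRr1 ?divr_ge0 ?(ltW k0)// mulrC divfK// gt_eqF.
Qed.

Lemma opt_frac01 c mu s : 0 < c -> 0 <= mu -> 0 <= s -> 0 <= opt_frac c mu s <= 1.
Proof.
move=> c0 mu0 s0; rewrite /opt_frac; have [_|mun0] := eqVneq mu 0; first by rewrite ler01 lexx.
have {mun0}mu0 : 0 < mu by rewrite lt0r mun0.
rewrite /theta_of; case: (ltP s mu) => [_|s1]; first by rewrite lexx ler01.
case: (leP s ((1 + c) * mu)) => [s2|_]; last by rewrite ler01 lexx.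
rewrite mulr_ge0 ?invr_ge0 ?(ltW c0)//=; last by rewrite subr_ge0 ler_pdivlMr// mul1r.
by rewrite mulrC ler_pdivrMr// mul1r lerBlDr ler_pdivrMr// addrC.
Qed.

Lemma tangency_ge0 c mu s : 0 < c -> 0 <= mu -> 0 <= s -> 0 <= tangency c mu s.
Proof.
move=> c0 mu0 s0; rewrite /tangency; case: (ltP s mu) => // _; case: (leP s ((1 + c) * mu)) => // _.
by rewrite divr_ge0//; lra.
Qed.

Lemma tangencyE c mu s : 0 < c -> 0 <= mu -> 0 <= s ->
  s = tangency c mu s * (1 + c * opt_frac c mu s).
Proof.
move=> c0 mu0 s0; rewrite /tangency /opt_frac /theta_of.
have [->|mun0] := eqVneq mu 0.
  case: ltP => [|_]; first lra.
  by case: leP => h; [lra|field; rewrite gt_eqF//; lra].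
have {mun0}mu0 : 0 < mu by rewrite lt0r mun0.
case: (ltP s mu) => [_|s1]; first ring.
case: (leP s ((1 + c) * mu)) => [s2|_]; last by field; rewrite gt_eqF//; lra.
by field; rewrite !gt_eqF.
Qed.

Lemma dFmu_tangency p c mu s : 1 < p -> 0 < c -> 0 <= s ->
  dFmu p c mu s = tangency c mu s `^ (p - 1).
Proof.
move=> p1 c0 s0; rewrite /dFmu /tangency; case: (ltP s mu) => // _; case: (leP s ((1 + c) * mu)) => // _.
have c1 : 0 <= 1 + c by lra.
rewrite powRM ?invr_ge0//; congr (_ * _).
by rewrite -[in RHS]powR_inv1// -powRrM mulN1r powRN.
Qed.

(** First-order optimality of [opt_frac] on [[0, 1]], in variational form: the
    derivative in [t] of the Lagrangian at [opt_frac] is a positive multiple of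
    [mu^p - tangency^p], which vanishes in the interior case, is nonnegative
    where [opt_frac] is 0 and nonpositive where it is 1. *)
Lemma tangency_gap p c mu s t : 1 < p -> 0 < c -> 0 <= mu -> 0 <= s ->
  0 <= t <= 1 ->
  0 <= (mu `^ p - tangency c mu s `^ p) * (t - opt_frac c mu s).
Proof.
move=> p1 c0 mu0 s0 /andP[t0 t1]; have p0 : 0 <= p by lra.
rewrite /tangency /opt_frac /theta_of.
have [->|mun0] := eqVneq mu 0.
  rewrite powR0; last by rewrite gt_eqF//; lra.
  by rewrite sub0r -mulrNN opprK mulr_ge0 ?powR_ge0//; lra.
have {mun0}mu0' : 0 < mu by rewrite lt0r mun0.
case: (ltP s mu) => [s1|s1].
  by rewrite subr0 mulr_ge0// subr_ge0 ge0_ler_powR// ?nnegrE// ltW.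
case: (leP s ((1 + c) * mu)) => [s2|s2]; first by rewrite subrr mul0r.
rewrite -mulrNN mulr_ge0 ?oppr_ge0 ?subr_le0// ge0_ler_powR// ?nnegrE//.
  by rewrite divr_ge0//; lra.
by rewrite ler_pdivlMr; [rewrite mulrC ltW|lra].
Qed.

Lemma Fmin_tangency p c mu s : 1 < p -> 0 < c -> 0 <= mu -> 0 <= s ->
  Fmin p c mu s = p^-1 * (tangency c mu s `^ p * (1 + c * opt_frac c mu s)) +
    multiplier p c mu * opt_frac c mu s.
Proof.
move=> p1 c0 mu0 s0; rewrite /Fmin /lagrangian; congr (_ * _ + _).
have /andP[t0 t1] := opt_frac01 c0 mu0 s0.
have y0 : 0 < 1 + c * opt_frac c mu s by rewrite ltr_pwDl// mulr_ge0// ltW.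
rewrite perspE// mulrC; congr (_ `^ p * _).
by rewrite {1}(tangencyE c0 mu0 s0) mulfK ?gt_eqF.
Qed.

(** The affine minorant of the Lagrangian at the optimal fraction, rewritten so
    that its value at the optimal fraction and its slopes are visible. *)
Let affineE p c mu s s' t : 1 < p -> 0 < c -> 0 <= mu -> 0 <= s ->
  Fmin p c mu s + dFmu p c mu s * (s' - s) +
    c * ((p - 1) / p) * ((mu `^ p - tangency c mu s `^ p) * (t - opt_frac c mu s))
  = p^-1 * (p * tangency c mu s `^ (p - 1) * s' -
            (p - 1) * tangency c mu s `^ p * (1 + c * t)) + multiplier p c mu * t.
Proof.
move=> p1 c0 mu0 s0; rewrite Fmin_tangency// dFmu_tangency// /multiplier.
have p0 : 0 < p by lra.
have a0 := tangency_ge0 c0 mu0 s0.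
rewrite [in X in _ * (_ - X)](tangencyE c0 mu0 s0) -(@mulr_powRB1 _ (tangency c mu s) p)//.
by field; rewrite gt_eqF.
Qed.

Lemma lagrangian_ge p c mu s s' t : 1 < p -> 0 < c -> 0 <= mu -> 0 <= s -> 0 <= s' ->
  0 <= t <= 1 ->
  Fmin p c mu s + dFmu p c mu s * (s' - s) +
    c * ((p - 1) / p) * ((mu `^ p - tangency c mu s `^ p) * (t - opt_frac c mu s))
  <= lagrangian p c mu s' t.
Proof.
move=> p1 c0 mu0 s0 s'0 /andP[t0 t1]; rewrite affineE// lerD2r ler_pM2l; last first.
  by rewrite invr_gt0; lra.
apply: persp_ge => //; last exact: tangency_ge0.
by rewrite ltr_pwDl// mulr_ge0// ltW.
Qed.

(** A single inequality with two uses: with [s' = s] it says that [opt_frac] is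
    optimal; with [t] optimal for [s'] it says that [dFmu] is a subgradient of
    the minimum. *)
Lemma Fmin_tangent p c mu s s' t : 1 < p -> 0 < c -> 0 <= mu -> 0 <= s -> 0 <= s' ->
  0 <= t <= 1 -> Fmin p c mu s + dFmu p c mu s * (s' - s) <= lagrangian p c mu s' t.
Proof.
move=> p1 c0 mu0 s0 s'0 t01; apply: le_trans (lagrangian_ge p1 c0 mu0 s0 s'0 t01).
rewrite lerDl mulr_ge0 ?tangency_gap//.
by rewrite mulr_ge0 ?(ltW c0)// divr_ge0//; lra.
Qed.

Lemma Fmin_le p c mu s t : 1 < p -> 0 < c -> 0 <= mu -> 0 <= s ->
  0 <= t <= 1 -> Fmin p c mu s <= lagrangian p c mu s t.
Proof.
move=> p1 c0 mu0 s0 t01; have := Fmin_tangent p1 c0 mu0 s0 s0 t01.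
by rewrite subrr mulr0 addr0.
Qed.

(** Uniqueness of the optimal fraction.  Either the first-order gap is strict, or
    the quotient [s / (1 + c * opt_frac)] equals [mu] and Young's inequality is
    strict.  It fails only for [s = mu = 0], where the Lagrangian vanishes. *)
Lemma Fmin_lt p c mu s t : 1 < p -> 0 < c -> 0 <= mu -> 0 <= s ->
  0 <= t <= 1 -> 0 < s \/ 0 < mu -> t != opt_frac c mu s ->
  Fmin p c mu s < lagrangian p c mu s t.
Proof.
move=> p1 c0 mu0 s0 t01 smu tn; have p0 : 0 < p by lra.
have k0 : 0 < c * ((p - 1) / p) by rewrite mulr_gt0// divr_gt0//; lra.
have a0 := tangency_ge0 c0 mu0 s0.
have [amu|amu] := eqVneq (tangency c mu s) mu; last first.
  apply: lt_le_trans (lagrangian_ge p1 c0 mu0 s0 s0 t01).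
  rewrite subrr mulr0 addr0 ltrDl mulr_gt0// lt0r tangency_gap// andbT.
  rewrite mulf_neq0// subr_eq0// eq_sym.
  by rewrite (inj_in_eq (powR_injective p0)) ?nnegrE.
have h : Fmin p c mu s = Fmin p c mu s + dFmu p c mu s * (s - s) +
    c * ((p - 1) / p) * ((mu `^ p - tangency c mu s `^ p) * (t - opt_frac c mu s)).
  by rewrite amu !subrr mul0r !mulr0 !addr0.
rewrite {}h affineE// ltrD2r ltr_pM2l ?invr_gt0//.
have {}mu0 : 0 < mu.
  case: smu => // s1; rewrite lt0r mu0 andbT; apply/eqP => mu0'.
  by move: s1; rewrite {1}(tangencyE c0 mu0 s0) amu mu0' mul0r ltxx.
have /andP[t0 t1] := t01.
apply: persp_gt => //; rewrite ?amu//.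
  by rewrite ltr_pwDl// mulr_ge0// ltW.
rewrite {1}(tangencyE c0 (ltW mu0) s0) amu (inj_eq (mulfI (lt0r_neq0 mu0))).
by rewrite (inj_eq (addrI _)) (inj_eq (mulfI (lt0r_neq0 c0))) eq_sym.
Qed.

Lemma Fmin_convex p c mu : 1 < p -> 0 < c -> 0 <= mu ->
  forall s s', 0 <= s -> 0 <= s' ->
  Fmin p c mu s + dFmu p c mu s * (s' - s) <= Fmin p c mu s'.
Proof. by move=> p1 c0 mu0 s s' s0 s'0; apply: Fmin_tangent => //; exact: opt_frac01. Qed.

End relaxed_integrand.

(** * Functions with a continuous subgradient *)

Section subgradient.
Context {R : realType}.
Variables F g : R -> R.
Hypothesis Fg : forall x y, 0 <= x -> 0 <= y -> F x + g x * (y - x) <= F y.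

(** The difference quotient lies between the subgradients at its end points, by
    the subgradient inequality at each of them.  Continuity of the subgradient
    then makes it a derivative, so no junction of branches has to be examined. *)
Lemma subgradient_quotient x h : 0 <= x -> 0 <= x + h -> h != 0 ->
  `|g x - h^-1 * (F (x + h) - F x)| <= `|g x - g (x + h)|.
Proof.
move=> x0 xh0 hn0.
have h1 := Fg x0 xh0; have h2 := Fg xh0 x0.
rewrite [x + h - x]addrAC subrr add0r in h1.
rewrite opprD addrA subrr sub0r in h2.
set D := F (x + h) - F x; have {}h1 : g x * h <= D by rewrite /D; lra.
have {}h2 : D <= g (x + h) * h by rewrite /D; lra.
have [h0|h0|h0] := ltgtP h 0; last by rewrite h0 eqxx in hn0.
- have q1 : h^-1 * D <= g x by rewrite mulrC ler_ndivrMr.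
  have q2 : g (x + h) <= h^-1 * D by rewrite [leRHS]mulrC ler_ndivlMr.
  by rewrite !ger0_norm ?subr_ge0//; [lra|exact: le_trans q1].
- have q1 : g x <= h^-1 * D by rewrite [leRHS]mulrC ler_pdivlMr.
  have q2 : h^-1 * D <= g (x + h) by rewrite mulrC ler_pdivrMr.
  by rewrite !ler0_norm ?subr_le0//; [lra|exact: le_trans q2].
Qed.

Hypothesis cg : continuous g.

Lemma subgradient_is_derive (x : R) : 0 < x -> is_derive (x : R^o) 1 (F : R^o -> R^o) (g x).
Proof.
move=> x0; have cvgF : h^-1 *: ((F \o shift x) (h *: (1 : R^o)) - F x) @[h --> 0^'] --> g x.
  apply/cvgrPdist_le => e e0.
  have gx : g (x + h) @[h --> 0^'] --> g x.
    apply: cvg_within_filter; rewrite -[in X in _ --> X](addr0 x).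
    by apply: continuous_cvg; [exact: cg|apply: cvgD; [exact: cvg_cst|exact: cvg_id]].
  move/cvgrPdist_le : gx => /(_ _ e0) gx.
  near=> h => /=; rewrite /GRing.scale/= /shift/=.
  rewrite [h * 1]mulr1 [h + x]addrC; apply: le_trans (near gx h _) => //.
  apply: subgradient_quotient; [exact: ltW| |by near: h; exact: nbhs_dnbhs_neq].
  rewrite -lerBlDl sub0r; near: h; apply: nbhs_dnbhs.
  by apply: lt_le_nbhsr; rewrite oppr_lt0.
split; first by apply/cvg_ex; exists (g x).
exact/cvg_lim.
Unshelve. all: by end_near. Qed.

Lemma subgradient_right_derive0 : (fun t : R => t^-1 * (F t - F 0)) @ 0^'+ --> g 0.
Proof.
apply/cvgrPdist_le => e e0.
have gx : g h @[h --> 0^'+] --> g 0 by apply: cvg_within_filter; exact: cg.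
move/cvgrPdist_le : gx => /(_ _ e0) gx.
near=> h => /=; apply: le_trans (near gx h _) => //.
have h0 : 0 < h by [].
by have := @subgradient_quotient 0 h; rewrite add0r; apply; [|exact: ltW|rewrite gt_eqF].
Unshelve. all: by end_near. Qed.

Lemma subgradient_cvg_right0 : F @ 0^'+ --> F 0.
Proof.
have h : (fun t : R => F 0 + t * (t^-1 * (F t - F 0))) @ 0^'+ --> F 0 + 0 * g 0.
  apply: cvgD; first exact: cvg_cst.
  apply: cvgM; last exact: subgradient_right_derive0.
  by apply: cvg_within_filter; exact: cvg_id.
rewrite mul0r addr0 in h; apply: cvg_trans h; apply: near_eq_cvg.
near=> t; have t0 : 0 < t by [].
by rewrite mulrA mulfV ?gt_eqF// mul1r addrC subrK.
Unshelve. all: by end_near. Qed.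

Lemma subgradient_integral (s : R) : 0 <= s ->
  \int[lebesgue_measure]_(t in `[0, s]) g t = F s - F 0.
Proof.
rewrite le_eqVlt => /predU1P[<-|s0]; first by rewrite set_itv1 Rintegral_set1 subrr.
rewrite /Rintegral (@continuous_FTC2 _ g F)//.
- exact: continuous_subspaceT.
- split; last 2 first.
  + exact: subgradient_cvg_right0.
  + apply: cvg_within_filter; apply: differentiable_continuous.
    by apply/derivable1_diffP; have [] := subgradient_is_derive s0.
  by move=> x; rewrite in_itv/= => /andP[x0 _]; have [] := subgradient_is_derive x0.
- by move=> x; rewrite in_itv/= => /andP[x0 _]; rewrite derive1E; have [] := subgradient_is_derive x0.
Qed.

Lemma subgradient_convex : convex_function (`[0, +oo[%classic : set R^o) F.
Proof.
move=> t x y; rewrite !inE/= !in_itv/= !andbT => x0 y0.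
have [a0 b0] : 0 <= t%:num /\ 0 <= 1 - t%:num by rewrite subr_ge0.
change (F (t%:num * x + (1 - t%:num) * y) <= t%:num * F x + (1 - t%:num) * F y).
move: t%:num a0 b0 => a a0 b0.
set z := a * _ + _.
have z0 : 0 <= z by rewrite addr_ge0// mulr_ge0.
have h1 := ler_wpM2l a0 (Fg z0 x0); have h2 := ler_wpM2l b0 (Fg z0 y0).
by apply: le_trans (lerD h1 h2); apply: le_of_eq; rewrite /z; ring.
Qed.

End subgradient.

(** * Regularity and convexity of the relaxed integrand *)

Section Fmu_convex_C1.
Context {R : realType}.

Lemma powR_continuous (r t : R) : 0 < t -> {for t, continuous (fun x : R => x `^ r)}.
Proof.
move=> t0.
have : derivable (fun y : R^o => y `^ r : R^o) (t : R^o) 1.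
  by apply: derivable_powR; rewrite in_itv/= andbT.
by move/derivable1_diffP/differentiable_continuous.
Qed.

(** The power is truncated to nonnegative arguments because real powers of
    negative numbers take the value 1, which breaks continuity at 0. *)
Lemma posPowR_continuous (r : R) : 0 < r -> continuous (fun x : R => (Num.max 0 x) `^ r).
Proof.
move=> r0 /= x; have [x0|x0|x0] := ltgtP x 0.
- apply: (@cvg_trans _ ((fun _ : R => 0 `^ r) @ nbhs x)).
    apply: near_eq_cvg; near=> y; rewrite max_l//.
    by near: y; exact: lt_le_nbhsl.
  by rewrite max_l ?ltW//; exact: cvg_cst.
- rewrite /continuous_at max_r ?ltW//; apply: (@cvg_trans _ ((fun y : R => y `^ r) @ nbhs x)).
    apply: near_eq_cvg; near=> y; rewrite max_r//.
    by near: y; exact: lt_le_nbhsr.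
  exact: powR_continuous.
- rewrite x0; apply/left_right_continuousP.
  rewrite maxxx powR0 ?gt_eqF//; split.
    apply: (@cvg_trans _ ((fun _ : R => (0 : R)) @ (0 : R)^'-)); last exact: cvg_cst.
    apply: near_eq_cvg; near=> y; have y0 : y < 0 by [].
    by rewrite max_l ?ltW// powR0// gt_eqF.
  apply: (@cvg_trans _ ((y `^ r) @[y --> (0 : R)^'+])); last exact: powR_cvg0.
  by apply: near_eq_cvg; near=> y; rewrite max_r// ltW.
Unshelve. all: by end_near. Qed.

(** An extension of [dFmu] from the half-line to a continuous function on the
    line: for nonnegative [s], [max (min s mu) (s / (1 + c))] is the point of
    tangency. *)
Definition dFmu_ext (p c mu s : R) : R :=
  Num.max 0 (Num.max (Num.min s mu) (s / (1 + c))) `^ (p - 1).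

Variables p c mu : R.
Hypotheses (p1 : 1 < p) (c0 : 0 < c) (mu0 : 0 <= mu).

Lemma dFmu_ext_continuous : continuous (dFmu_ext p c mu).
Proof.
have cmin : continuous (fun s : R => Num.min s mu).
  by move=> x; apply: (@continuous_min R _ id (fun=> mu)); [exact: cvg_id|exact: cvg_cst].
have cdiv : continuous (fun s : R => s / (1 + c)).
  by move=> x; apply: cvgM; [exact: cvg_id|exact: cvg_cst].
have cmax : continuous (fun s : R => Num.max (Num.min s mu) (s / (1 + c))).
  by move=> x; exact: (continuous_max (cmin x) (cdiv x)).
have cpow : continuous (fun x : R => Num.max 0 x `^ (p - 1)).
  by apply: posPowR_continuous; rewrite subr_gt0.
by move=> x; exact: (continuous_comp (cmax x) (cpow _)).
Qed.

Lemma dFmu_extE s : 0 <= s -> dFmu_ext p c mu s = dFmu p c mu s.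
Proof.
move=> s0; rewrite dFmu_tangency// /dFmu_ext; congr (_ `^ _).
have c1 : 0 < 1 + c by rewrite addr_gt0.
have sc : s / (1 + c) <= s by rewrite ler_pdivrMr// mulrDr mulr1 lerDl mulr_ge0// ltW.
rewrite max_r; last by rewrite le_max; apply/orP; right; rewrite divr_ge0// ltW.
rewrite /tangency; case: (ltP s mu) => [smu|mus]; first by rewrite max_l.
case: leP => [s2|s2]; first by rewrite max_l// ler_pdivrMr// mulrC.
by rewrite max_r// ler_pdivlMr// mulrC ltW.
Qed.

Lemma Fmin0 : Fmin p c mu 0 = 0.
Proof.
rewrite Fmin_tangency//.
have a0 : tangency c mu 0 = 0.
  rewrite /tangency; case: ltP => // mule0; case: leP => h; last by rewrite mul0r.
  by apply/eqP; rewrite eq_le mule0.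
rewrite a0 powR0 ?mul0r ?mulr0 ?add0r; last by rewrite gt_eqF// (lt_trans ltr01).
rewrite /opt_frac; have [->|mun0] := eqVneq mu 0; first by rewrite multiplier0// mul0r.
by rewrite /theta_of lt0r mun0 mu0 mulr0.
Qed.

(** The pointwise minimum has the continuous derivative [dFmu] and vanishes at
    0, hence is the integral that defines [Fmu]. *)
Lemma FmuE s : 0 <= s -> Fmu p c mu s = Fmin p c mu s.
Proof.
move=> s0; rewrite -[RHS]subr0 -Fmin0 -(@subgradient_integral _ _ (dFmu_ext p c mu))//.
- by apply: eq_Rintegral => t; rewrite inE/= in_itv/= => /andP[t0 _]; rewrite dFmu_extE.
- by move=> x y x0 y0; rewrite dFmu_extE//; exact: Fmin_convex.
- exact: dFmu_ext_continuous.
Qed.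

Lemma Fmu_subgradient x y : 0 <= x -> 0 <= y ->
  Fmu p c mu x + dFmu_ext p c mu x * (y - x) <= Fmu p c mu y.
Proof. by move=> x0 y0; rewrite !FmuE// dFmu_extE//; exact: Fmin_convex. Qed.

Lemma dFmu_ge0 s : 0 <= s -> 0 <= dFmu p c mu s.
Proof. by move=> s0; rewrite -dFmu_extE// powR_ge0. Qed.

Lemma Fmu_0 : Fmu p c mu 0 = 0.
Proof. by rewrite FmuE// Fmin0. Qed.

Lemma Fmu_ge0 s : 0 <= s -> 0 <= Fmu p c mu s.
Proof.
move=> s0; have := @Fmu_subgradient 0 s (lexx _) s0.
rewrite Fmu_0 add0r subr0 dFmu_extE//; apply: le_trans.
by rewrite mulr_ge0// dFmu_ge0.
Qed.

Lemma dFmu_within_continuous : {within `[0, +oo[%classic, continuous (dFmu p c mu)}.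
Proof.
apply: (@subspace_eq_continuous _ _ _ (dFmu_ext p c mu)); last first.
  exact: continuous_subspaceT dFmu_ext_continuous.
by move=> x; rewrite inE/= in_itv/= andbT => x0; rewrite /from_subspace/= dFmu_extE.
Qed.

Lemma Fmu_is_derive (s : R) : 0 < s ->
  is_derive (s : R^o) 1 (Fmu p c mu : R^o -> R^o) (dFmu p c mu s).
Proof.
move=> s0; rewrite -dFmu_extE ?ltW//; apply: subgradient_is_derive => //.
  exact: Fmu_subgradient.
exact: dFmu_ext_continuous.
Qed.

Lemma Fmu_C1 : C1_halfline (Fmu p c mu) (dFmu p c mu).
Proof.
split; [exact: dFmu_within_continuous|exact: Fmu_is_derive|].
rewrite -dFmu_extE//; apply: subgradient_right_derive0.
  exact: Fmu_subgradient.
exact: dFmu_ext_continuous.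
Qed.

Lemma Fmu_convex : convex_function (`[0, +oo[%classic : set R^o) (Fmu p c mu).
Proof. by apply: subgradient_convex; exact: Fmu_subgradient. Qed.

End Fmu_convex_C1.

(** * Weak derivatives of piecewise smooth functions on a half-line *)

Section weak_derivatives.
Context {R : realType}.
Notation leb := (@lebesgue_measure R).

(** Half-open intervals make consecutive pieces disjoint with union an interval
    of the same form, and let [h] follow the left branch at each junction. *)
Definition ibp_on (phi H h : R -> R) (x y : R) :=
  [/\ leb.-integrable `]x, y] (EFin \o (fun t => H t * derive1 (phi : R^o -> R^o) t)),
      leb.-integrable `]x, y] (EFin \o (fun t => h t * phi t)) &
      \int[leb]_(t in `]x, y]) (H t * derive1 (phi : R^o -> R^o) t) =
      H y * phi y - H x * phi x - \int[leb]_(t in `]x, y]) (h t * phi t)].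

(** Integration by parts is applied to a function [K] that is differentiable up
    to the end points and agrees with [H] on the interval; [H] itself may have
    corners there. *)
Lemma ibp_branch (K k phi H h : R -> R) (x y : R) :
  (forall n (x : R), derivable (derive1n n (phi : R^o -> R^o)) x 1) -> x < y ->
  (forall t : R, x <= t <= y -> is_derive (t : R^o) 1 (K : R^o -> R^o) (k t)) ->
  (forall t : R, x <= t <= y -> {for t, continuous k}) ->
  (forall t, x <= t <= y -> H t = K t) ->
  (forall t, x < t <= y -> h t = k t) -> ibp_on phi H h x y.
Proof.
move=> dphi xy dK ck HK hk.
have cphi : continuous phi.
  by move=> t; apply: differentiable_continuous; apply/derivable1_diffP; exact: (dphi 0%N).
have cphi' : continuous (derive1 (phi : R^o -> R^o) : R -> R).
  by move=> t; apply: differentiable_continuous; apply/derivable1_diffP; exact: (dphi 1%N).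
have cK (t : R) : x <= t <= y -> {for t, continuous K}.
  by move=> /dK[dKt _]; apply: differentiable_continuous; apply/derivable1_diffP.
have subI : `]x, y] `<=` `[x, y] by apply: subset_itvr; rewrite bnd_simp.
have wc (f : R -> R) : (forall t : R, x <= t <= y -> {for t, continuous f}) ->
    {within `[x, y], continuous f}.
  move=> cf; apply: continuous_in_subspaceT => t; rewrite inE/= in_itv/=; exact: cf.
have int (f : R -> R) : (forall t : R, x <= t <= y -> {for t, continuous f}) ->
    leb.-integrable `[x, y] (EFin \o f).
  by move=> cf; apply: continuous_compact_integrable;
    [exact: segment_compact|exact: wc].
have i1 : leb.-integrable `[x, y] (EFin \o (fun t => K t * derive1 (phi : R^o -> R^o) t)).
  by apply: int => t /cK cKt; apply: cvgM; [exact: cKt|exact: cphi'].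
have i2 : leb.-integrable `[x, y] (EFin \o (fun t => k t * phi t)).
  by apply: int => t /ck ckt; apply: cvgM; [exact: ckt|exact: cphi].
have HKo : {in `]x, y]%classic, forall t,
    H t * derive1 (phi : R^o -> R^o) t = K t * derive1 (phi : R^o -> R^o) t}.
  by move=> t; rewrite inE => /subI/=; rewrite in_itv/= => /HK ->.
have hko : {in `]x, y]%classic, forall t, h t * phi t = k t * phi t}.
  by move=> t; rewrite inE/= in_itv/= => /hk ->.
have j1 : leb.-integrable `]x, y] (EFin \o (fun t => K t * derive1 (phi : R^o -> R^o) t)).
  exact: integrableS i1.
have j2 : leb.-integrable `]x, y] (EFin \o (fun t => k t * phi t)).
  exact: integrableS i2.
split.
- by apply: eq_integrable j1 => // t /HKo/= ->.
- by apply: eq_integrable j2 => // t /hko/= ->.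
have -> : \int[leb]_(t in `]x, y]) (H t * derive1 (phi : R^o -> R^o) t) =
    \int[leb]_(t in `]x, y]) (K t * derive1 (phi : R^o -> R^o) t) by exact: eq_Rintegral.
have -> : \int[leb]_(t in `]x, y]) (h t * phi t) = \int[leb]_(t in `]x, y]) (k t * phi t).
  exact: eq_Rintegral.
rewrite !Rintegral_itv_obnd_cbnd//.
rewrite !HK ?lexx ?(ltW xy)//.
apply: Rintegration_by_parts => //.
- exact: wc.
- split.
  + by move=> t; rewrite in_itv/= => /andP[/ltW xt /ltW ty]; have [] := dK t; rewrite ?xt.
  + by apply: cvg_within_filter; apply: cK; rewrite lexx ltW.
  + by apply: cvg_within_filter; apply: cK; rewrite lexx ltW.
- move=> t; rewrite in_itv/= => /andP[/ltW xt /ltW ty]; rewrite derive1E.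
  by have [] := dK t; rewrite ?xt.
- by apply: wc => t _; exact: cphi'.
- split.
  + by move=> t _; exact: (dphi 0%N).
  + by apply: cvg_within_filter; exact: cphi.
  + by apply: cvg_within_filter; exact: cphi.
Qed.

Lemma integrable_disjU d (T : measurableType d) (m : {measure set T -> \bar R})
    (A B : set T) (f : T -> \bar R) :
  measurable A -> measurable B -> [disjoint A & B] ->
  m.-integrable A f -> m.-integrable B f -> m.-integrable (A `|` B) f.
Proof.
move=> mA mB AB /integrableP[mfA fA] /integrableP[mfB fB].
have mf := (measurable_funU f mA mB).2 (conj mfA mfB).
apply/integrableP; split => //.
rewrite ge0_integral_setU//; first by rewrite lte_add_pinfty.
exact: measurableT_comp.
Qed.

Lemma ibp_cat phi H h (x y z : R) : x < y -> y < z ->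
  ibp_on phi H h x y -> ibp_on phi H h y z -> ibp_on phi H h x z.
Proof.
move=> xy yz [i1 i2 e] [j1 j2 e'].
have xyz : `]x, z]%classic = `]x, y]%classic `|` `]y, z]%classic :> set R.
  by rewrite -itv_bndbnd_setU// bnd_simp ltW.
have d : [disjoint `]x, y]%classic & `]y, z]%classic].
  apply/disj_setPS => t [/=]; rewrite 2!in_itv/= => /andP[_ ty] /andP[].
  by rewrite ltNge ty.
have k1 : leb.-integrable `]x, z] (EFin \o (fun t => H t * derive1 (phi : R^o -> R^o) t)).
  by rewrite xyz; apply: integrable_disjU.
have k2 : leb.-integrable `]x, z] (EFin \o (fun t => h t * phi t)).
  by rewrite xyz; apply: integrable_disjU.
split => //; rewrite xyz !Rintegral_setU -?xyz//= e e'; ring.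
Qed.

(** Outside the support of the test function both integrands vanish, so the
    half-line reduces to an interval whose end points lie outside the support
    and the boundary terms disappear. *)
Lemma ibp_weak_derive (H h : R -> R) :
  (forall phi a b, (forall n (x : R), derivable (derive1n n (phi : R^o -> R^o)) x 1) ->
    0 < a -> exists x y : R, [/\ 0 < x < a, b < y & ibp_on phi H h x y]) ->
  weak_derive_pos H h.
Proof.
move=> Hh phi [dphi [a [b [a0 phi0]]]].
have [x [y [/andP[x0 xa] by' [i1 i2 e]]]] := Hh phi a b dphi a0.
have phix : phi x = 0 by rewrite phi0// (leNgt a) xa.
have phiy : phi y = 0 by rewrite phi0// andbC (leNgt _ b) by'.
have phi'0 t : ~~ (a <= t <= b) -> derive1 (phi : R^o -> R^o) t = 0.
  move=> tab; rewrite derive1E (@near_eq_derive _ _ _ _ (cst (0 : R^o))) ?derive_cst//.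
  move: tab; rewrite negb_and -!ltNge => /orP[ta|bt].
    near=> s; rewrite phi0//= negb_and -!ltNge; apply/orP; left.
    by near: s; exact: lt_nbhsl.
  near=> s; rewrite phi0//= negb_and -!ltNge; apply/orP; right.
  by near: s; exact: lt_nbhsr.
have red (f g : R -> R) : (forall t, ~~ (a <= t <= b) -> g t = 0) ->
    \int[leb]_(t in `]0, +oo[) (f t * g t) = \int[leb]_(t in `]x, y]) (f t * g t).
  move=> g0; rewrite [LHS]Rintegral_mkcond [RHS]Rintegral_mkcond.
  apply: eq_Rintegral => t _; rewrite !patchE.
  have [ab|ab] := boolP (a <= t <= b); last by rewrite g0// mulr0 !if_same.
  have /andP[at' tb] := ab.
  rewrite !mem_set//= in_itv/=; last by rewrite andbT; exact: lt_le_trans a0 at'.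
  by rewrite (lt_le_trans xa at') (le_trans tb (ltW by')).
by rewrite !red// e phix phiy !mulr0 subrr sub0r.
Unshelve. all: by end_near. Qed.

End weak_derivatives.

Section Fmu_W2oo.
Context {R : realType}.
Variables p c mu : R.
Hypotheses (p1 : 1 < p) (c0 : 0 < c) (mu0 : 0 <= mu).

Definition ddFmu (s : R) : R :=
  if s <= mu then (p - 1) * s `^ (p - 1 - 1)
  else if s <= (1 + c) * mu then 0
  else (p - 1) * s `^ (p - 1 - 1) / (1 + c) `^ (p - 1).

Let c1_gt0 : 0 < 1 + c. Proof. by rewrite addr_gt0. Qed.

Lemma Fmu_weak_derive : weak_derive_pos (Fmu p c mu) (dFmu p c mu).
Proof.
apply: ibp_weak_derive => phi a b dphi a0.
exists (a / 2), (Num.max a b + 1).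
have ha : 0 < a / 2 < a by rewrite divr_gt0//= ltr_pdivrMr// mulr_natr mulr2n ltrDl.
split=> //; first by rewrite ltr_pwDr// le_max lexx orbT.
have ltxy : a / 2 < Num.max a b + 1.
  by have /andP[_ h] := ha; rewrite (lt_trans h)// ltr_pwDr// le_max lexx.
have pos t : a / 2 <= t <= Num.max a b + 1 -> 0 < t.
  by move=> /andP[h _]; apply: lt_le_trans h; case/andP: ha.
apply: (@ibp_branch _ (Fmu p c mu) (dFmu p c mu)) => //.
- by move=> t /pos t0; exact: Fmu_is_derive.
- move=> t /pos t0.
  have /continuous_within_itvcyP[cd _] : {within `[0, +oo[%classic, continuous (dFmu p c mu)}.
  exact: dFmu_within_continuous.
  by apply: cd; rewrite in_itv/= andbT.
Qed.

Lemma is_derive_scaled_powR (k t : R) : 0 < t ->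
  is_derive (t : R^o) 1 (fun s : R^o => s `^ (p - 1) * k : R^o) ((p - 1) * t `^ (p - 1 - 1) * k).
Proof.
move=> t0; have d := is_derive1_powR (p - 1) t0.
have -> : (fun s : R^o => s `^ (p - 1) * k : R^o) = k \*: ((@powR R) ^~ (p - 1) : R^o -> R^o).
  by apply/funext => s; rewrite mulrC.
apply: is_derive_eq (is_deriveZ _ d) _.
by rewrite /GRing.scale/= mulrC.
Qed.

Lemma scaled_powR_continuous (k t : R) : 0 < t ->
  {for t, continuous (fun s : R => (p - 1) * s `^ (p - 1 - 1) * k)}.
Proof.
move=> t0; apply: cvgM; last exact: cvg_cst.
by apply: cvgM; [exact: cvg_cst|exact: powR_continuous].
Qed.

(** Integration by parts on the three branches; the boundary terms cancel at
    the junctions since [dFmu] is continuous.  For [mu = 0] only the last branch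
    meets the half-line. *)
Lemma dFmu_weak_derive : weak_derive_pos (dFmu p c mu) ddFmu.
Proof.
apply: ibp_weak_derive => phi a b dphi a0.
pose x := if mu == 0 then a / 2 else Num.min a mu / 2.
pose y := Num.max (Num.max a b) ((1 + c) * mu) + 1.
have c1p : (1 + c) `^ (p - 1) != 0 by rewrite gt_eqF// powR_gt0.
have muc : mu <= (1 + c) * mu by rewrite ler_peMl// lerDl ltW.
(* The last branch, started at its junction or, for [mu = 0], anywhere. *)
have high z : 0 < z -> (1 + c) * mu <= z -> mu = 0 \/ (1 + c) * mu = z -> z < y ->
  ibp_on phi (dFmu p c mu) ddFmu z y.
  move=> z0 muz hz zy.
  apply: (@ibp_branch _ (fun s => s `^ (p - 1) * ((1 + c) `^ (p - 1))^-1)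
    (fun s => (p - 1) * s `^ (p - 1 - 1) * ((1 + c) `^ (p - 1))^-1)) => //.
  - by move=> t /andP[zt _]; apply: is_derive_scaled_powR; exact: lt_le_trans zt.
  - by move=> t /andP[zt _]; apply: scaled_powR_continuous; exact: lt_le_trans zt.
  - move=> t /andP[zt _]; rewrite /dFmu ltNge (le_trans muc (le_trans muz zt))/=.
    case: ifPn => // tmu.
    case: hz => [mu00|cmuz].
      by move: (lt_le_trans z0 (le_trans zt tmu)); rewrite mu00 mulr0 ltxx.
    have -> : t = (1 + c) * mu by apply/eqP; rewrite eq_le tmu cmuz.
    by rewrite powRM ?(ltW c1_gt0)// mulrAC mulfV// mul1r.
  - move=> t /andP[zt _]; rewrite /ddFmu.
    by rewrite !leNgt (le_lt_trans muz zt) (le_lt_trans muc (le_lt_trans muz zt)).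
have yb : b < y by rewrite ltr_pwDr// !le_max lexx orbT.
have ay : a < y by rewrite ltr_pwDr// !le_max lexx.
have muy : (1 + c) * mu < y by rewrite ltr_pwDr// !le_max lexx !orbT.
exists x, y; rewrite /x; have [mu00|mun0] := eqVneq mu 0.
  have ha : 0 < a / 2 < a by rewrite divr_gt0//= ltr_pdivrMr// mulr_natr mulr2n ltrDl.
  have /andP[a20 a2a] := ha.
  split=> //; apply: high => //; rewrite ?mu00 ?mulr0; [exact: ltW|by left|].
  exact: lt_trans ay.
have mupos : 0 < mu by rewrite lt0r mun0.
have m0 : 0 < Num.min a mu by rewrite lt_min a0.
have m2 : Num.min a mu / 2 < Num.min a mu.
  by rewrite ltr_pdivrMr// mulr_natr mulr2n ltrDl.
have x0 : 0 < Num.min a mu / 2 by rewrite divr_gt0.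
have xmu : Num.min a mu / 2 < mu by apply: lt_le_trans m2 _; rewrite ge_min lexx orbT.
have mucs : mu < (1 + c) * mu by rewrite ltr_pMl// ltrDl.
split=> //.
  by rewrite x0/=; apply: lt_le_trans m2 _; rewrite ge_min lexx.
apply: (ibp_cat xmu (lt_trans mucs muy)).
  apply: (@ibp_branch _ (fun s => s `^ (p - 1) * 1)
    (fun s => (p - 1) * s `^ (p - 1 - 1) * 1)) => //.
  - by move=> t /andP[zt _]; apply: is_derive_scaled_powR; exact: lt_le_trans zt.
  - by move=> t /andP[zt _]; apply: scaled_powR_continuous; exact: lt_le_trans zt.
  - move=> t /andP[_ tmu]; rewrite /dFmu mulr1; case: ifPn => // mut.
    have -> : t = mu by apply/eqP; rewrite eq_le tmu leNgt.
    by rewrite muc.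
  - by move=> t /andP[_ tmu]; rewrite /ddFmu tmu mulr1.
apply: (ibp_cat mucs muy).
  apply: (@ibp_branch _ (fun=> mu `^ (p - 1)) (fun=> 0)) => //.
  - by move=> t _; exact: cvg_cst.
  - by move=> t /andP[mut tm]; rewrite /dFmu ltNge mut/= tm.
  - by move=> t /andP[mut tm]; rewrite /ddFmu leNgt mut/= tm.
by apply: high => //; [exact: lt_trans mucs|right].
Qed.

Lemma Fmu_W2oo : W2oo_loc_pos (Fmu p c mu).
Proof.
have /continuous_within_itvcyP[cd _] : {within `[0, +oo[%classic, continuous (dFmu p c mu)}.
  exact: dFmu_within_continuous.
exists (dFmu p c mu), ddFmu; split; last 2 first.
- exact: Fmu_weak_derive.
- exact: dFmu_weak_derive.
- split.
    apply: open_continuous_measurable_fun; first exact: interval_open.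
    move=> t; rewrite inE/= in_itv/= andbT => t0.
    have [d _] := Fmu_is_derive p1 c0 mu0 t0.
    by apply: differentiable_continuous; apply/derivable1_diffP.
  move=> a b a0; exists (Fmu p c mu b); apply: aeW => x /andP[ax xb].
  have x0 : 0 <= x by rewrite ltW// (lt_le_trans a0).
  rewrite ger0_norm ?Fmu_ge0//.
  have := Fmu_subgradient p1 c0 mu0 x0 (le_trans x0 xb).
  apply: le_trans; rewrite lerDl mulr_ge0 ?subr_ge0//.
  by rewrite dFmu_extE// dFmu_ge0.
- split.
    apply: open_continuous_measurable_fun; first exact: interval_open.
    by move=> t; rewrite inE => t0; exact: cd.
  move=> a b a0; exists (dFmu p c mu b); apply: aeW => x /andP[ax xb].
  have x0 : 0 <= x by rewrite ltW// (lt_le_trans a0).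
  rewrite ger0_norm ?dFmu_ge0//.
  have b0 := le_trans x0 xb.
  have := Fmu_subgradient p1 c0 mu0 x0 b0.
  have := Fmu_subgradient p1 c0 mu0 b0 x0.
  rewrite !dFmu_extE//; move: xb; rewrite le_eqVlt => /predU1P[->//|xb h1 h2].
  have : 0 <= (dFmu p c mu b - dFmu p c mu x) * (b - x).
    by move: h1 h2; move: (dFmu _ _ _ _) (dFmu _ _ _ _) (Fmu _ _ _ _) (Fmu _ _ _ _) => *; lra.
  by rewrite pmulr_lge0 ?subr_gt0// subr_ge0.
- split.
    apply: measurable_funTS; apply: measurable_fun_ifT.
    - exact: measurable_fun_ler.
    - exact: measurable_funM.
    - apply: measurable_fun_ifT => //; first exact: measurable_fun_ler.
      by apply: measurable_funM => //; exact: measurable_funM.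
  move=> a b a0; exists ((p - 1) * (a `^ (p - 1 - 1) + b `^ (p - 1 - 1)) * (1 + ((1 + c) `^ (p - 1))^-1)).
  apply: aeW => x /andP[ax xb].
  have x0 : 0 < x by exact: lt_le_trans ax.
  have p10 : 0 <= p - 1 by rewrite subr_ge0 ltW.
  have c1i : 0 <= ((1 + c) `^ (p - 1))^-1 by rewrite invr_ge0 powR_ge0.
  have xle : x `^ (p - 1 - 1) <= a `^ (p - 1 - 1) + b `^ (p - 1 - 1).
    have [p2|p2] := leP 0 (p - 1 - 1).
      rewrite ler_wpDl ?powR_ge0// ge0_ler_powR// nnegrE ?ltW//.
      exact: lt_le_trans xb.
    (* for a negative exponent the power is largest at the left end *)
    have [q qE] : exists q, p - 1 - 1 = - q by exists (- (p - 1 - 1)); rewrite opprK.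
    have q0 : 0 <= q by rewrite -oppr_le0 -qE ltW.
    rewrite ler_wpDr ?powR_ge0// qE !powRN lef_pV2 ?posrE ?powR_gt0//.
    by rewrite ge0_ler_powR// nnegrE ltW.
  set A := (p - 1) * (_ + _).
  have A0 : 0 <= A by rewrite mulr_ge0// addr_ge0// powR_ge0.
  have xA : (p - 1) * x `^ (p - 1 - 1) <= A by rewrite ler_wpM2l.
  rewrite mulrDr mulr1 /ddFmu; case: ifPn => _.
    rewrite ger0_norm ?mulr_ge0 ?powR_ge0// (le_trans xA)// lerDl mulr_ge0//.
  case: ifPn => _; first by rewrite normr0 addr_ge0// mulr_ge0.
  rewrite ger0_norm ?mulr_ge0 ?powR_ge0//.
  by rewrite (le_trans (ler_wpM2r c1i xA))// lerDr.
Qed.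

End Fmu_W2oo.

(** * Borel sets of R^n and the Euclidean norm *)

Section rV_borel.
Context {R : realType}.

Lemma measurable_fun_rV d (T : measurableType d) n (D : set T) (f : T -> 'rV[R]_n) :
  (forall i, measurable_fun D (fun x => f x ord0 i : measurableTypeR R)) ->
  measurable_fun D f.
Proof.
move=> mf mD; suff : measurable_fun D f by apply.
have sG : @measurable _ 'rV[R]_n = <<s \big[setU/set0]_(i < n)
    preimage_set_system setT (fun x : 'rV[R]_n => x ord0 i : measurableTypeR R) measurable >>.
  by [].
apply: (measurability _ sG).
move=> _ [B + <-]; rewrite -bigcup_seq => -[i _ [C mC <-]].
by rewrite setTI -comp_preimage; exact: mf.
Qed.

Let box n (k : 'rV[rat]_n * rat) : set 'rV[R]_n :=
  [set y | forall i, ratr (k.1 ord0 i) - ratr k.2 < y ord0 i < ratr (k.1 ord0 i) + ratr k.2].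

Let measurable_box n k : measurable (@box n k).
Proof.
rewrite (_ : box k = \bigcap_(i in [set: 'I_n])
  ((fun x : 'rV[R]_n => x ord0 i : measurableTypeR R) @^-1`
    `]ratr (k.1 ord0 i) - ratr k.2, ratr (k.1 ord0 i) + ratr k.2[%classic)).
  apply: fin_bigcap_measurable => // i _; rewrite -[X in measurable X]setTI.
  exact: measurable_coor.
apply/seteqP; split => x /=.
  by move=> H i _ /=; rewrite in_itv /= H.
by move=> H i; have := H i I; rewrite /= in_itv.
Qed.

(** An open set is the union of the boxes with rational centres and radii that
    it contains, and there are countably many of them. *)
Lemma open_measurable_rV n (U : set 'rV[R]_n) : open U -> measurable U.
Proof.
move=> oU.
have -> : U = \bigcup_k (if `[< @box n k `<=` U >] then @box n k else set0).
  apply/seteqP; split => [x Ux|x [k _]]; last by case: ifPn => // /asboolP; apply.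
  have := oU x Ux; rewrite -nbhs_ballE => -[e /= e0 xeU].
  have [r] := rat_in_itvoo (divr_gt0 e0 (ltr0Sn R 1)).
  rewrite in_itv/= => /andP[r0 re].
  have /choice[q qx] : forall i, exists q : rat, x ord0 i - ratr r < ratr q < x ord0 i + ratr r.
    move=> i; have [|q] := @rat_in_itvoo R (x ord0 i - ratr r) (x ord0 i + ratr r).
      lra.
    by rewrite in_itv/= => qx; exists q.
  have bx : box (\row_i q i, r) x.
    by move=> i; rewrite /= !mxE; have := qx i; lra.
  exists (\row_i q i, r) => //; rewrite asboolT//.
  move=> y by'; apply: xeU; split=> // i j; rewrite [i]ord1.
  have := qx j; have := by' j; rewrite /= !mxE /ball/= => *.
  rewrite ltr_norml; lra.
apply: countable_bigcupT_measurable; first exact: countableP.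
by move=> k; case: ifPn => // _; exact: measurable_box.
Qed.

Lemma continuous_measurable_rV n (f : 'rV[R]_n -> R) : continuous f ->
  measurable_fun setT (f : _ -> measurableTypeR R).
Proof.
move=> /continuousP cf; apply: (measurability _ (RGenOpens.measurableE R)).
move=> _ [_ [a [b ->] <-]]; rewrite setTI; apply: open_measurable_rV.
exact/cf/interval_open.
Qed.

Lemma bounded_lebesgue_rV_fin n (D : set 'rV[R]_n) : measurable D ->
  bounded_set D -> (lebesgue_rV n D < +oo)%E.
Proof.
move=> mD [M [_ DM]].
pose K := `|M| + 1.
have K0 : 0 <= K by rewrite addr_ge0.
have MK : M < K by rewrite (le_lt_trans (ler_norm _))// ltrDl.
pose a : 'rV[R]_n := \row_i (- K); pose b : 'rV[R]_n := \row_i K.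
have ab i : a ord0 i <= b ord0 i by rewrite !mxE; lra.
apply: (@le_lt_trans _ _ (lebesgue_rV n
    [set x : 'rV[R]_n | forall i, a ord0 i <= x ord0 i <= b ord0 i])); last first.
  by rewrite lebesgue_rV_box// ltry.
apply: le_measure; rewrite ?inE//.
  rewrite (_ : [set x : 'rV[R]_n | forall i, a ord0 i <= x ord0 i <= b ord0 i] =
    \bigcap_(i in [set: 'I_n]) ((fun x : 'rV[R]_n => x ord0 i : measurableTypeR R)
      @^-1` `[a ord0 i, b ord0 i]%classic)).
    apply: fin_bigcap_measurable => // i _; rewrite -[X in measurable X]setTI.
    exact: measurable_coor.
  apply/seteqP; split => x /=.
    by move=> H i _ /=; rewrite in_itv /= H.
  by move=> H i; have := H i I; rewrite /= in_itv.
move=> x Dx i; rewrite !mxE -ler_norml; apply: le_trans (DM _ MK _ Dx).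
rewrite [leRHS]/Num.Def.normr /= mx_normrE; apply/bigmax_geP; right => /=.
by exists (ord0, i).
Qed.

End rV_borel.

Section euclidean_norm.
Context {R : realType} {n : nat}.
Implicit Types u v : 'rV[R]_n.

Lemma enorm_ge0 v : 0 <= enorm v. Proof. exact: sqrtr_ge0. Qed.

Lemma enormZ (a : R) v : enorm (a *: v) = `|a| * enorm v.
Proof.
rewrite /enorm -sqrtr_sqr -sqrtrM ?sqr_ge0// mulr_sumr.
by congr Num.sqrt; apply: eq_bigr => i _; rewrite mxE exprMn.
Qed.

Lemma CauchySchwarz_row u v :
  (\sum_i u ord0 i * v ord0 i) ^+ 2 <= (\sum_i u ord0 i ^+ 2) * (\sum_i v ord0 i ^+ 2).
Proof.
set A := \sum_i u ord0 i ^+ 2; set B := \sum_i v ord0 i ^+ 2; set C := \sum_i _.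
have A0 : 0 <= A by apply: sumr_ge0 => i _; exact: sqr_ge0.
have B0 : 0 <= B by apply: sumr_ge0 => i _; exact: sqr_ge0.
have q (s t : R) : 0 <= s ^+ 2 * A - 2 * s * t * C + t ^+ 2 * B.
  have -> : s ^+ 2 * A - 2 * s * t * C + t ^+ 2 * B =
      \sum_i (s * u ord0 i - t * v ord0 i) ^+ 2.
    rewrite !mulr_sumr -sumrB -big_split/=; apply: eq_bigr => i _; ring.
  by apply: sumr_ge0 => i _; exact: sqr_ge0.
have [A0'|An0] := eqVneq A 0.
  have u0 i : u ord0 i = 0.
    apply/eqP; rewrite -sqrf_eq0; apply/eqP; move: A0'.
    by move/psumr_eq0P; apply => // j _; exact: sqr_ge0.
  by rewrite A0' mul0r /C big1 ?expr0n// => i _; rewrite u0 mul0r.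
have {An0}A0 : 0 < A by rewrite lt0r An0.
(* the minimum over [s] of the quadratic form with [t = A] is at [s = C] *)
have := q C A; rewrite (_ : _ + _ = A * (A * B - C ^+ 2)); last by ring.
by rewrite pmulr_rge0// subr_ge0.
Qed.

Lemma enormD u v : enorm (u + v) <= enorm u + enorm v.
Proof.
have S0 w : 0 <= \sum_(i < n) (w : 'rV[R]_n) ord0 i ^+ 2.
  by apply: sumr_ge0 => i _; exact: sqr_ge0.
rewrite -(@ler_pXn2r _ 2)// ?nnegrE ?addr_ge0 ?enorm_ge0//.
rewrite sqrrD !sqr_sqrtr//.
have -> : \sum_i (u + v) ord0 i ^+ 2 = \sum_i u ord0 i ^+ 2 +
    (\sum_i u ord0 i * v ord0 i) *+ 2 + \sum_i v ord0 i ^+ 2.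
  by rewrite -sumrMnl -!big_split/=; apply: eq_bigr => i _; rewrite mxE; ring.
rewrite lerD2r lerD2l lerMn2r//= -sqrtrM//.
apply: le_trans (ler_norm _) _; rewrite -sqrtr_sqr ler_sqrt ?CauchySchwarz_row//.
by rewrite mulr_ge0.
Qed.

Lemma enorm_convex (t : R) u v : 0 <= t <= 1 ->
  enorm (t *: u + (1 - t) *: v) <= t * enorm u + (1 - t) * enorm v.
Proof.
move=> /andP[t0 t1]; apply: le_trans (enormD _ _) _.
by rewrite !enormZ !ger0_norm// subr_ge0.
Qed.

Lemma measurable_enorm : measurable_fun setT (@enorm R n : _ -> measurableTypeR R).
Proof.
rewrite (_ : enorm = (@powR R ^~ 2^-1) \o (fun v : 'rV[R]_n => \sum_i v ord0 i ^+ 2)).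
  apply: measurableT_comp; first exact: measurable_powR.
  apply: measurable_sum => i; apply: measurable_funX; exact: measurable_coor.
apply/funext => v /=; rewrite powR12_sqrt//.
by apply: sumr_ge0 => i _; exact: sqr_ge0.
Qed.

End euclidean_norm.

(** * Linear combinations of test functions *)

Section test_functions.
Context {R : realType} {N : nat}.
Implicit Types phi psi : 'rV[R]_N -> R^o.

Lemma partial_comb (a b : R) i phi psi :
  (forall x, derivable phi x (delta_mx ord0 i)) ->
  (forall x, derivable psi x (delta_mx ord0 i)) ->
  partial i (fun x => a * phi x + b * psi x) =
  (fun x => a * partial i phi x + b * partial i psi x).
Proof.
move=> dphi dpsi; apply/funext => x; rewrite /partial.
rewrite (@deriveD _ _ _ (a \*: phi) (b \*: psi)); [|exact: derivableZ..].
by rewrite !deriveZ.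
Qed.

(** Smoothness of [phi] and [psi] supplies the derivability of every iterated
    partial derivative, which is what the induction needs at each step. *)
Lemma foldr_partial_comb (a b : R) phi psi s : smooth phi -> smooth psi ->
  foldr partial (fun x => a * phi x + b * psi x) s =
  (fun x => a * foldr partial phi s x + b * foldr partial psi s x).
Proof.
move=> sphi spsi; elim: s => //= i s ->; apply: partial_comb => x.
  by have [_] := sphi s; exact.
by have [_] := spsi s; exact.
Qed.

Lemma smooth_comb (a b : R) phi psi : smooth phi -> smooth psi ->
  smooth (fun x => a * phi x + b * psi x).
Proof.
move=> sphi spsi s /=; rewrite foldr_partial_comb//.
have [cphi dphi] := sphi s; have [cpsi dpsi] := spsi s; split.
  have cM (k : R) (g : 'rV[R]_N -> R^o) : continuous g -> continuous (fun x => k * g x : R^o).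
    by move=> cg x; apply: (@cvgM _ _ (nbhs x) _ (cst k) g); [exact: cvg_cst|exact: cg].
  by move=> x; exact: (cvgD (cM a _ cphi x) (cM b _ cpsi x)).
move=> i x; apply: (@derivableD _ _ _ (a \*: foldr partial phi s) (b \*: foldr partial psi s)).
  by apply: derivableZ; exact: dphi.
by apply: derivableZ; exact: dpsi.
Qed.

Lemma test_function_comb Om (a b : R) phi psi : test_function Om phi ->
  test_function Om psi -> test_function Om (fun x => a * phi x + b * psi x).
Proof.
move=> [sphi [K [cK KOm phi0]]] [spsi [L [cL LOm psi0]]].
split; first exact: smooth_comb.
exists (K `|` L); split; first exact: compactU.
  by move=> x [/KOm|/LOm].
by move=> x /not_orP[Kx Lx]; rewrite phi0// psi0// !mulr0 addr0.
Qed.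

Lemma gradient_comb (a b : R) phi psi : smooth phi -> smooth psi ->
  gradient (fun x => a * phi x + b * psi x) =
  (fun x => a *: gradient phi x + b *: gradient psi x).
Proof.
move=> sphi spsi; apply/funext => x; apply/rowP => i; rewrite !mxE partial_comb//.
  by move=> y; have [_] := sphi [::]; exact.
by move=> y; have [_] := spsi [::]; exact.
Qed.

Lemma smooth_continuous phi : smooth phi -> continuous phi.
Proof. by move=> /(_ [::])[]. Qed.

Lemma smooth_partial_continuous i phi : smooth phi -> continuous (partial i phi).
Proof. by move=> /(_ [:: i])[]. Qed.

Lemma measurable_gradient phi : smooth phi -> measurable_fun setT (gradient phi).
Proof.
move=> sphi; apply: measurable_fun_rV => i.
rewrite (_ : (fun x => _) = partial i phi).
  by apply: continuous_measurable_rV; exact: smooth_partial_continuous.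
by apply/funext => x; rewrite mxE.
Qed.

(** The complement of a compact set is open, so [phi] vanishes near each of its
    points. *)
Lemma partial_eq0_off (K : set 'rV[R]_N) i phi : compact K ->
  (forall x, ~ K x -> phi x = 0) -> forall x, ~ K x -> partial i phi x = 0.
Proof.
move=> cK phi0 x Kx; rewrite /partial (@near_eq_derive _ _ _ _ (cst (0 : R^o))) ?derive_cst//.
have oK : open (~` K) by apply: closed_openC; apply: compact_closed cK; exact: norm_hausdorff.
by apply: filterS (oK x Kx) => y /phi0.
Qed.

Lemma compactly_supported_bounded (K : set 'rV[R]_N) (g : 'rV[R]_N -> R^o) :
  compact K -> continuous g -> (forall x, ~ K x -> g x = 0) ->
  [bounded g x | x in setT].
Proof.
move=> cK cg g0.
have /compact_bounded[M [Mr gM]] : compact (g @` K).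
  by apply: continuous_compact => //; exact: continuous_subspaceT.
exists (Num.max M 0); split; first by rewrite num_real.
move=> m; rewrite gt_max => /andP[Mm m0] x _ /=.
have [Kx|Kx] := pselect (K x); first by apply: gM => //; exists x.
by rewrite g0// normr0 ltW.
Qed.

Lemma test_function_bounded Om phi : test_function Om phi ->
  [bounded phi x | x in setT].
Proof.
move=> [sphi [K [cK _ phi0]]].
by apply: compactly_supported_bounded phi0 => //; exact: smooth_continuous.
Qed.

Lemma test_function_partial_bounded Om i phi : test_function Om phi ->
  [bounded partial i phi x | x in setT].
Proof.
move=> [sphi [K [cK _ phi0]]].
have := @compactly_supported_bounded K (partial i phi) cK.
apply; [exact: smooth_partial_continuous|exact: partial_eq0_off].
Qed.

End test_functions.

(** * Convexity of the Sobolev spaces *)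

Section W1p_convex.
Context {R : realType} {N : nat}.
Variables (Om : set 'rV[R]_N) (p : R).
Hypotheses (mOm : measurable Om) (finOm : (lebesgue_rV N Om < +oo)%E) (p1 : 1 < p).
Notation lam := (lebesgue_rV N).
Local Notation RR := (measurableTypeR R).
Implicit Types (t : R) (u v : wfun R N).

(** A pair of functions mixes componentwise: the second component is the weak
    gradient of the mixture. *)
Definition wmix t u v : wfun R N := t *: u + (1 - t) *: v.

Lemma powR_convex t (x y : R) : 0 <= t <= 1 -> 0 <= x -> 0 <= y ->
  (t * x + (1 - t) * y) `^ p <= t * x `^ p + (1 - t) * y `^ p.
Proof.
move=> t01 x0 y0; have := persp_convex p1 t01 x0 y0 (@ltr01 R) ltr01.
rewrite !powR1 !divr1 !mulr1 (_ : t + (1 - t) = 1) ?powR1 ?divr1//; ring.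
Qed.

Definition measurable_wfun u :=
  measurable_fun Om (u.1 : _ -> RR) /\ measurable_fun Om u.2.

Lemma measurable_wfun_mix t u v : measurable_wfun u -> measurable_wfun v ->
  measurable_wfun (wmix t u v).
Proof.
move=> [u1 u2] [v1 v2]; split.
  by apply: measurable_funD; apply: measurable_funM.
apply: measurable_fun_rV => i.
rewrite (_ : (fun x => _) = fun x => t * u.2 x ord0 i + (1 - t) * v.2 x ord0 i); last first.
  by apply/funext => x; rewrite !mxE.
by apply: measurable_funD; apply: measurable_funM => //;
  apply: (measurableT_comp (measurable_coor i)).
Qed.

Lemma measurable_powR_abs u : measurable_wfun u ->
  measurable_fun Om (fun x => (`|u.1 x| `^ p)%:E).
Proof.
move=> [u1 _]; apply/measurable_EFinP.
apply: (measurableT_comp (measurable_powR p)).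
exact: measurableT_comp.
Qed.

Lemma measurable_enorm_snd u : measurable_wfun u ->
  measurable_fun Om (fun x => enorm (u.2 x) : RR).
Proof. by move=> [_ u2]; apply: (measurableT_comp measurable_enorm). Qed.

Lemma measurable_powR_enorm u : measurable_wfun u ->
  measurable_fun Om (fun x => (enorm (u.2 x) `^ p)%:E).
Proof.
move=> mu; apply/measurable_EFinP; apply: (measurableT_comp (measurable_powR p)).
exact: measurable_enorm_snd.
Qed.

Lemma integral_mix_le (f g h : 'rV[R]_N -> R) t : 0 <= t <= 1 ->
  measurable_fun Om (EFin \o f) -> measurable_fun Om (EFin \o g) ->
  measurable_fun Om (EFin \o h) ->
  (forall x, 0 <= f x) -> (forall x, 0 <= g x) -> (forall x, 0 <= h x) ->
  (forall x, Om x -> h x <= t * f x + (1 - t) * g x) ->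
  (\int[lam]_(x in Om) (h x)%:E <= t%:E * \int[lam]_(x in Om) (f x)%:E +
    (1 - t)%:E * \int[lam]_(x in Om) (g x)%:E)%E.
Proof.
move=> /andP[t0 t1] mf mg mh f0 g0 h0 hfg.
have t1' : 0 <= 1 - t by rewrite subr_ge0.
have Z (k : R) (e : 'rV[R]_N -> R) : 0 <= k -> measurable_fun Om (EFin \o e) ->
    (forall x, 0 <= e x) ->
    (k%:E * \int[lam]_(x in Om) (e x)%:E = \int[lam]_(x in Om) (k * e x)%:E)%E.
  by move=> k0 me e0; rewrite -ge0_integralZl// => x _; rewrite lee_fin.
have M (k : R) (e : 'rV[R]_N -> R) : measurable_fun Om (EFin \o e) ->
    measurable_fun Om (fun x => (k * e x)%:E).
  move=> /measurable_EFinP me; apply/measurable_EFinP.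
  by apply: measurable_funM => //; exact: measurable_cst.
rewrite !Z// -ge0_integralD//; first last.
- exact: M.
- by move=> x _; rewrite lee_fin mulr_ge0.
- exact: M.
- by move=> x _; rewrite lee_fin mulr_ge0.
apply: ge0_le_integral => //.
- by move=> x _; rewrite lee_fin.
- by apply: emeasurable_funD; exact: M.
Qed.

Lemma integral_fst_mix t u v : 0 <= t <= 1 -> measurable_wfun u -> measurable_wfun v ->
  (\int[lam]_(x in Om) (`|(wmix t u v).1 x| `^ p)%:E <=
   t%:E * \int[lam]_(x in Om) (`|u.1 x| `^ p)%:E +
   (1 - t)%:E * \int[lam]_(x in Om) (`|v.1 x| `^ p)%:E)%E.
Proof.
move=> t01 mu mv; have /andP[t0 t1] := t01.
apply: integral_mix_le => //; try by move=> x; exact: powR_ge0.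
- exact: measurable_powR_abs.
- exact: measurable_powR_abs.
- by apply: measurable_powR_abs; apply: measurable_wfun_mix.
move=> x _; apply: le_trans (powR_convex t01 (normr_ge0 _) (normr_ge0 _)).
have t1' : 0 <= 1 - t by rewrite subr_ge0.
rewrite ge0_ler_powR// ?nnegrE ?addr_ge0 ?mulr_ge0//; first by rewrite ltW// (lt_trans ltr01).
by rewrite (le_trans (ler_normD _ _))// !normrM !(ger0_norm t0) (ger0_norm t1').
Qed.

Lemma integral_snd_mix t u v : 0 <= t <= 1 -> measurable_wfun u -> measurable_wfun v ->
  (\int[lam]_(x in Om) (enorm ((wmix t u v).2 x) `^ p)%:E <=
   t%:E * \int[lam]_(x in Om) (enorm (u.2 x) `^ p)%:E +
   (1 - t)%:E * \int[lam]_(x in Om) (enorm (v.2 x) `^ p)%:E)%E.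
Proof.
move=> t01 mu mv; have /andP[t0 t1] := t01.
apply: integral_mix_le => //; try by move=> x; exact: powR_ge0.
- exact: measurable_powR_enorm.
- exact: measurable_powR_enorm.
- by apply: measurable_powR_enorm; apply: measurable_wfun_mix.
move=> x _; apply: le_trans (powR_convex t01 (enorm_ge0 _) (enorm_ge0 _)).
have t1' : 0 <= 1 - t by rewrite subr_ge0.
rewrite ge0_ler_powR// ?nnegrE ?addr_ge0 ?mulr_ge0 ?enorm_ge0//; first by rewrite ltW// (lt_trans ltr01).
exact: enorm_convex.
Qed.

(** On a set of finite measure, [|g| <= 1 + |g|^p]. *)
Lemma integrable_of_powR (g : 'rV[R]_N -> R) : measurable_fun Om (EFin \o g) ->
  (\int[lam]_(x in Om) (`|g x| `^ p)%:E < +oo)%E -> lam.-integrable Om (EFin \o g).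
Proof.
move=> mg gp.
have mgp : measurable_fun Om (EFin \o (fun x => `|g x| `^ p)).
  apply/measurable_EFinP; apply: (measurableT_comp (measurable_powR p)).
  by apply: measurableT_comp => //; exact/measurable_EFinP.
have i1 : lam.-integrable Om (EFin \o cst 1).
  by apply: measurable_bounded_integrable => //; exists 1; split => // m m1 x _ /=;
    rewrite normr1 ltW.
have i2 : lam.-integrable Om (EFin \o (fun x => `|g x| `^ p)).
  apply/integrableP; split => //.
  by under eq_integral do rewrite /= ger0_norm ?powR_ge0//.
apply: le_integrable (integrableD mOm i1 i2) => //.
move=> x _; rewrite /= lee_fin [leRHS]ger0_norm ?addr_ge0 ?powR_ge0//.
have [g1|g1] := leP `|g x| 1; first by rewrite ler_wpDr ?powR_ge0.
by rewrite ler_wpDl// le1r_powR// ltW.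
Qed.

End W1p_convex.

Section W1p0_convex.
Context {R : realType} {N : nat}.
Variables (Om : set 'rV[R]_N) (p : R).
Hypotheses (mOm : measurable Om) (finOm : (lebesgue_rV N Om < +oo)%E) (p1 : 1 < p).
Notation lam := (lebesgue_rV N).
Local Notation RR := (measurableTypeR R).
Implicit Types (t : R) (u v : wfun R N).

Lemma Rintegral_mix t (f g : 'rV[R]_N -> R) :
  lam.-integrable Om (EFin \o f) -> lam.-integrable Om (EFin \o g) ->
  \int[lam]_(x in Om) (t * f x + (1 - t) * g x) =
  t * \int[lam]_(x in Om) f x + (1 - t) * \int[lam]_(x in Om) g x.
Proof.
move=> fi gi; rewrite -!RintegralZl// RintegralD//.
  exact: (integrableZl mOm t fi).
exact: (integrableZl mOm (1 - t) gi).
Qed.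

Lemma coor_le_enorm (v : 'rV[R]_N) i : `|v ord0 i| <= enorm v.
Proof.
rewrite -sqrtr_sqr ler_sqrt; last by apply: sumr_ge0 => j _; exact: sqr_ge0.
rewrite (bigD1 i)//= lerDl; apply: sumr_ge0 => j _; exact: sqr_ge0.
Qed.

Lemma W1p_measurable u : W1p Om p u -> measurable_wfun Om u.
Proof. by case. Qed.

Lemma W1p_integrable_fst u : W1p Om p u -> lam.-integrable Om (EFin \o u.1).
Proof.
move=> [mu1 _ up _ _]; apply: (integrable_of_powR mOm finOm p1) => //.
exact/measurable_EFinP.
Qed.

Lemma W1p_measurable_coor u i : W1p Om p u ->
  measurable_fun Om (fun x => u.2 x ord0 i : RR).
Proof. by move=> [_ mu2 _ _ _]; apply: (measurableT_comp (measurable_coor i)). Qed.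

Lemma W1p_integrable_coor u i : W1p Om p u ->
  lam.-integrable Om (EFin \o (fun x => u.2 x ord0 i)).
Proof.
move=> Wu; case: (Wu) => mu1 mu2 up gp _.
have mc := W1p_measurable_coor i Wu.
apply: (integrable_of_powR mOm finOm p1).
  exact/measurable_EFinP.
apply: le_lt_trans gp; apply: ge0_le_integral => //.
- apply/measurable_EFinP; apply: (measurableT_comp (measurable_powR p)).
  exact: measurableT_comp.
- exact: measurable_powR_enorm.
- move=> x _; rewrite lee_fin ge0_ler_powR ?nnegrE ?enorm_ge0 ?coor_le_enorm//.
  by rewrite ltW// (lt_trans ltr01).
Qed.

Lemma integrable_mul_bounded (g h : 'rV[R]_N -> R) :
  lam.-integrable Om (EFin \o g) -> measurable_fun setT (h : _ -> RR) ->
  [bounded h x : R^o | x in setT] -> lam.-integrable Om (EFin \o (fun x => g x * h x)).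
Proof.
move=> gi mh [M [Mr hM]]; apply: (integrableMl mOm gi); first exact: measurable_funTS.
by exists M; split => // m Mm x _; exact: hM.
Qed.

(** Splitting the integrals needs each product with a test function or one of
    its partial derivatives to be integrable: the latter are bounded, and
    functions in L^p are integrable because [Om] has finite measure. *)
Lemma weak_gradient_mix t u v : W1p Om p u -> W1p Om p v ->
  weak_gradient Om (wmix t u v).1 (wmix t u v).2.
Proof.
move=> Wu Wv phi i Tphi; have sphi := Tphi.1.
have eu := let: And5 _ _ _ _ wu := Wu in wu phi i Tphi.
have ev := let: And5 _ _ _ _ wv := Wv in wv phi i Tphi.
have mphi := continuous_measurable_rV (smooth_continuous sphi).
have mdphi := continuous_measurable_rV (@smooth_partial_continuous _ _ i _ sphi).
have bphi := test_function_bounded Tphi.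
have bdphi := test_function_partial_bounded i Tphi.
transitivity (\int[lam]_(x in Om) (t * (u.1 x * partial i phi x) + (1 - t) * (v.1 x * partial i phi x))).
  by apply: eq_Rintegral => x _ /=; rewrite mulrDl !mulrA.
have hu := integrable_mul_bounded (W1p_integrable_fst Wu) mdphi bdphi.
have hv := integrable_mul_bounded (W1p_integrable_fst Wv) mdphi bdphi.
have gu := integrable_mul_bounded (W1p_integrable_coor i Wu) mphi bphi.
have gv := integrable_mul_bounded (W1p_integrable_coor i Wv) mphi bphi.
rewrite (Rintegral_mix t hu hv).
rewrite eu ev !mulrN -opprD -(Rintegral_mix t gu gv).
by congr (- _); apply: eq_Rintegral => x _ /=; rewrite !mxE; ring.
Qed.

Lemma mix_lt_pinfty t (a b : \bar R) : 0 <= t <= 1 -> (0 <= a)%E -> (0 <= b)%E ->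
  (a < +oo)%E -> (b < +oo)%E -> (t%:E * a + (1 - t)%:E * b < +oo)%E.
Proof.
move=> /andP[t0 t1] a0 b0 ay by'.
by rewrite lte_add_pinfty// lte_mul_pinfty// lee_fin subr_ge0.
Qed.

Lemma W1p_mix t u v : 0 <= t <= 1 -> W1p Om p u -> W1p Om p v -> W1p Om p (wmix t u v).
Proof.
move=> t01 Wu Wv; have /andP[t0 t1] := t01.
have mu := W1p_measurable Wu; have mv := W1p_measurable Wv.
have [mw1 mw2] := measurable_wfun_mix t mu mv.
have [_ _ u1 u2 _] := Wu; have [_ _ v1 v2 _] := Wv.
split; [exact: mw1|exact: mw2| | |exact: weak_gradient_mix].
- apply: le_lt_trans (integral_fst_mix mOm p1 t01 mu mv) _.
  by apply: mix_lt_pinfty u1 v1 => //; apply: integral_ge0 => x _; rewrite lee_fin powR_ge0.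
- apply: le_lt_trans (integral_snd_mix mOm p1 t01 mu mv) _.
  by apply: mix_lt_pinfty u2 v2 => //; apply: integral_ge0 => x _; rewrite lee_fin powR_ge0.
Qed.

(** A convex combination is at most the larger of its terms, hence a power of it
    at most the sum of the powers.  This replaces Minkowski's inequality, as
    only convergence to 0 is at stake. *)
Lemma poweR_mix_le t (r : R) (a b m : \bar R) : 0 <= t <= 1 -> 0 <= r ->
  (0 <= a)%E -> (0 <= b)%E -> (0 <= m)%E ->
  (m <= t%:E * a + (1 - t)%:E * b)%E -> (m `^ r <= a `^ r + b `^ r)%E.
Proof.
move=> /andP[t0 t1] r0 a0 b0 m0 mab.
have t1' : 0 <= 1 - t by rewrite subr_ge0.
have pm (x y : \bar R) : (0 <= x)%E -> (x <= y)%E -> (x `^ r <= y `^ r)%E.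
  move=> x0 xy; apply: gt0_ler_poweR => //; first by rewrite in_itv/= x0 leey.
  by rewrite in_itv/= (le_trans x0 xy) leey.
have [ab|ba] := leP a b.
  apply: (@le_trans _ _ (b `^ r)%E); last by rewrite leeDr// poweR_ge0.
  apply: pm => //; apply: le_trans mab _.
  apply: (@le_trans _ _ (t%:E * b + (1 - t)%:E * b)%E).
    by rewrite leeD2r// lee_wpmul2l.
  by rewrite -ge0_muleDl ?lee_fin// -EFinD addrC subrK mul1e.
apply: (@le_trans _ _ (a `^ r)%E); last by rewrite leeDl// poweR_ge0.
apply: pm => //; apply: le_trans mab _.
apply: (@le_trans _ _ (t%:E * a + (1 - t)%:E * a)%E).
  by rewrite leeD2l// lee_wpmul2l// ltW.
by rewrite -ge0_muleDl ?lee_fin// -EFinD addrC subrK mul1e.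
Qed.

Lemma W1p_norm_mix t u v : 0 <= t <= 1 -> measurable_wfun Om u -> measurable_wfun Om v ->
  (W1p_norm Om p (wmix t u v) <= W1p_norm Om p u + W1p_norm Om p v)%E.
Proof.
move=> t01 mu mv; have /andP[t0 t1] := t01.
pose I w := (\int[lam]_(x in Om) (`|(w : wfun R N).1 x| `^ p)%:E +
    \int[lam]_(x in Om) (enorm (w.2 x) `^ p)%:E)%E.
have I0 w : (0 <= I w)%E.
  by rewrite adde_ge0// integral_ge0// => x _; rewrite lee_fin powR_ge0.
have Imix : (I (wmix t u v) <= t%:E * I u + (1 - t)%:E * I v)%E.
  have h1 := integral_fst_mix mOm p1 t01 mu mv.
  have h2 := integral_snd_mix mOm p1 t01 mu mv.
  apply: le_trans (leeD h1 h2) _.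
  have n0 (h : 'rV[R]_N -> R) : (0 <= \int[lam]_(x in Om) (h x `^ p)%:E)%E.
    by apply: integral_ge0 => x _; rewrite lee_fin powR_ge0.
  by rewrite addeACA -!ge0_muleDr// lexx.
apply: (poweR_mix_le t01 _ _ _ _ Imix); [|exact: I0..].
by rewrite invr_ge0 ltW// (lt_trans ltr01).
Qed.

Lemma measurable_wfun_sub_test u phi : measurable_wfun Om u -> smooth phi ->
  measurable_wfun Om (u - ((phi, gradient phi) : wfun R N)).
Proof.
move=> [mu1 mu2] sphi; split.
  apply: measurable_funB => //; apply: measurable_funTS.
  by apply: continuous_measurable_rV; exact: smooth_continuous.
apply: measurable_fun_rV => i.
rewrite (_ : (fun x => _) = fun x => u.2 x ord0 i - gradient phi x ord0 i); last first.
  by apply/funext => x; rewrite !mxE.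
apply: measurable_funB; apply: (measurableT_comp (measurable_coor i)) => //.
by apply: measurable_funTS; exact: measurable_gradient.
Qed.

(** The mixtures of the approximating test functions approximate the mixture. *)
Lemma W1p0_mix t u v : 0 <= t <= 1 -> W1p0 Om p u -> W1p0 Om p v ->
  W1p0 Om p (wmix t u v).
Proof.
move=> t01 [Wu [phi [Tphi cphi]]] [Wv [psi [Tpsi cpsi]]].
split; first exact: W1p_mix.
exists (fun k x => t * phi k x + (1 - t) * psi k x); split.
  by move=> k; apply: test_function_comb.
have mu k := measurable_wfun_sub_test (W1p_measurable Wu) (Tphi k).1.
have mv k := measurable_wfun_sub_test (W1p_measurable Wv) (Tpsi k).1.
have E k : wmix t u v - ((fun x => t * phi k x + (1 - t) * psi k x,
      gradient (fun x => t * phi k x + (1 - t) * psi k x)) : wfun R N) =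
    wmix t (u - ((phi k, gradient (phi k)) : wfun R N))
           (v - ((psi k, gradient (psi k)) : wfun R N)).
  rewrite gradient_comb; [|exact: (Tphi k).1|exact: (Tpsi k).1].
  rewrite /wmix !scalerBr addrACA -opprD; congr (_ - _).
under eq_fun do rewrite E.
have := cvgeD _ cphi cpsi; rewrite adde0 => /(_ _ isT) s0.
apply: (squeeze_cvge _ (cvg_cst 0%E) s0).
near=> k; rewrite poweR_ge0/=; exact: W1p_norm_mix.
Unshelve. all: by end_near. Qed.

(** The approximation of 0 is by the products of 0 with the approximations
    of [u], which are test functions. *)
Lemma W1p0_0 u : W1p0 Om p u -> W1p0 Om p (0 : wfun R N).
Proof.
move=> [_ [phi [Tphi _]]].
have p0 : p != 0 by rewrite gt_eqF// (lt_trans ltr01).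
have e1 : (\int[lam]_(x in Om) (`|(0 : wfun R N).1 x| `^ p)%:E = 0)%E.
  by apply: integral0_eq => x _; rewrite normr0 powR0.
have e2 : (\int[lam]_(x in Om) (enorm ((0 : wfun R N).2 x) `^ p)%:E = 0)%E.
  apply: integral0_eq => x _; have -> : (0 : wfun R N).2 x = 0 *: 0 by rewrite scale0r.
  by rewrite enormZ normr0 mul0r powR0.
split.
  split.
  - exact: (measurable_cst (0 : RR)).
  - exact: (measurable_cst (0 : 'rV[R]_N)).
  - by rewrite e1 ltry.
  - by rewrite e2 ltry.
  - move=> psi i _.
    have z (h : 'rV[R]_N -> R) : (forall x, h x = 0) -> \int[lam]_(x in Om) h x = 0.
      by move=> h0; rewrite /Rintegral integral0_eq// => x _; rewrite h0.
    rewrite [LHS]z; last by move=> x; rewrite mul0r.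
    by rewrite z ?oppr0// => x; rewrite mxE mul0r.
exists (fun k x => 0 * phi k x + 0 * phi k x); split.
  by move=> k; apply: test_function_comb.
have E k : (0 : wfun R N) - ((fun x => 0 * phi k x + 0 * phi k x,
    gradient (fun x => 0 * phi k x + 0 * phi k x)) : wfun R N) = 0.
  rewrite gradient_comb; [|exact: (Tphi k).1|exact: (Tphi k).1].
  rewrite sub0r (_ : (_, _) = 0) ?oppr0//; congr (_, _).
    by apply/funext => x; rewrite !mul0r addr0.
  by apply/funext => x; rewrite !scale0r addr0.
under eq_fun do rewrite E.
rewrite (_ : W1p_norm Om p 0 = 0%E); first exact: cvg_cst.
by rewrite /W1p_norm e1 e2 adde0 poweR0r// invr_eq0.
Qed.

End W1p0_convex.

(** * The energies as finite integrals *)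

Section energies.
Context {R : realType} {N : nat}.
Variables (Om : set 'rV[R]_N) (p c : R).
Hypotheses (mOm : measurable Om) (finOm : (lebesgue_rV N Om < +oo)%E).
Hypotheses (p1 : 1 < p) (c0 : 0 < c).
Notation lam := (lebesgue_rV N).
Local Notation RR := (measurableTypeR R).
Implicit Types (u v : wfun R N) (theta : 'rV[R]_N -> R).

Definition density u theta (x : 'rV[R]_N) : R :=
  enorm (u.2 x) `^ p / (1 + c * theta x) `^ (p - 1).

(** Bounds at every point rather than almost every point; [clamp01] passes from
    one to the other without changing any integral. *)
Definition vol_frac theta :=
  measurable_fun Om (theta : _ -> RR) /\ forall x, 0 <= theta x <= 1.

Definition clamp01 (s : R) : R := Num.max 0 (Num.min 1 s).

Lemma clamp01_itv s : 0 <= clamp01 s <= 1.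
Proof. by rewrite le_max lexx/= ge_max ler01/= ge_min lexx. Qed.

Lemma clamp01_id s : 0 <= s <= 1 -> clamp01 s = s.
Proof. by move=> /andP[s0 s1]; rewrite /clamp01 min_r// max_r. Qed.

Lemma Loo01_vol_frac theta : Loo01 Om theta -> vol_frac (clamp01 \o theta).
Proof.
move=> [mtheta _]; split; last by move=> x; exact: clamp01_itv.
by apply: measurable_maxr => //; apply: measurable_minr.
Qed.

Lemma vol_frac_Loo01 theta : vol_frac theta -> Loo01 Om theta.
Proof. by move=> [mtheta t01]; split => //; apply: aeW. Qed.

Lemma Loo01_clamp theta : Loo01 Om theta ->
  {ae lam, forall x, Om x -> theta x = clamp01 (theta x)}.
Proof.
by move=> [_]; apply: filterS => x t01 Omx; rewrite clamp01_id// t01.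
Qed.

Lemma measurable_density u theta : measurable_wfun Om u ->
  measurable_fun Om (theta : _ -> RR) -> measurable_fun Om (density u theta : _ -> RR).
Proof.
move=> mu mtheta.
rewrite (_ : density u theta =
  fun x => enorm (u.2 x) `^ p * (1 + c * theta x) `^ (- (p - 1))); last first.
  by apply/funext => x; rewrite powRN.
apply: measurable_funM.
  by apply: (measurableT_comp (measurable_powR p)); exact: measurable_enorm_snd.
apply: (measurableT_comp (measurable_powR _)).
by apply: measurable_funD => //; exact: measurable_funM.
Qed.

Lemma density_ge0 u theta x : 0 <= density u theta x.
Proof. by rewrite mulr_ge0 ?invr_ge0 ?powR_ge0. Qed.

Lemma integrable_powR_enorm u : W1p Om p u ->
  lam.-integrable Om (EFin \o (fun x => enorm (u.2 x) `^ p)).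
Proof.
move=> Wu; apply/integrableP; split.
  by apply: measurable_powR_enorm; exact: W1p_measurable Wu.
under eq_integral do rewrite /= ger0_norm ?powR_ge0//.
by case: Wu.
Qed.

Lemma integrable_density u theta : W1p Om p u -> vol_frac theta ->
  lam.-integrable Om (EFin \o density u theta).
Proof.
move=> Wu [mtheta t01]; apply: le_integrable (integrable_powR_enorm Wu) => //.
  apply/measurable_EFinP; apply: measurable_density => //.
  exact: W1p_measurable Wu.
move=> x Omx; rewrite /= lee_fin !ger0_norm ?density_ge0 ?powR_ge0//.
have /andP[t0 t1] := t01 x.
have c1 : 1 <= (1 + c * theta x) `^ (p - 1).
  suff : 1 `^ (p - 1) <= (1 + c * theta x) `^ (p - 1) by rewrite powR1.
  rewrite ge0_ler_powR// ?nnegrE ?subr_ge0 ?(ltW p1)//.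
    by rewrite addr_ge0// mulr_ge0// ltW.
  by rewrite lerDl mulr_ge0// ltW.
by rewrite ler_pdivrMr ?(lt_le_trans ltr01)// ler_peMr ?powR_ge0.
Qed.

Lemma integrable_vol_frac theta : vol_frac theta ->
  lam.-integrable Om (EFin \o theta).
Proof.
move=> [mtheta t01]; apply: measurable_bounded_integrable => //.
exists 1; split => // m m1 x _ /=; have /andP[t0 t1] := t01 x.
by rewrite ger0_norm// (le_trans t1)// ltW.
Qed.

Lemma EFin_Rintegral (g : 'rV[R]_N -> R) : lam.-integrable Om (EFin \o g) ->
  (\int[lam]_(x in Om) (g x)%:E = (\int[lam]_(x in Om) g x)%:E)%E.
Proof. by move=> gi; rewrite /Rintegral fineK//; exact: integrable_fin_num. Qed.

Lemma integral_Loo01 theta : Loo01 Om theta ->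
  (\int[lam]_(x in Om) (theta x)%:E = (\int[lam]_(x in Om) clamp01 (theta x))%:E)%E.
Proof.
move=> Ltheta; have vt := Loo01_vol_frac Ltheta.
rewrite -EFin_Rintegral; last exact: integrable_vol_frac vt.
apply: ae_eq_integral => //.
- by apply/measurable_EFinP; case: Ltheta.
- by apply/measurable_EFinP; case: vt.
- by apply: filterS (Loo01_clamp Ltheta) => x h Omx; rewrite -h.
Qed.

Lemma R_energyE (f : wfun R N -> R) u theta : W1p Om p u -> Loo01 Om theta ->
  R_energy Om p c f (u, theta) =
  (p^-1 * \int[lam]_(x in Om) density u (clamp01 \o theta) x - f u)%:E.
Proof.
move=> Wu Ltheta; have vt := Loo01_vol_frac Ltheta.
rewrite EFinB EFinM -EFin_Rintegral; last exact: integrable_density.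
rewrite /R_energy/=. congr (adde _ _). congr (mule _ _).
have mu := W1p_measurable Wu.
apply: (@ae_eq_integral _ _ _ lam Om (EFin \o density u (clamp01 \o theta)) (EFin \o density u theta)) => //.
- by apply/measurable_EFinP; apply: measurable_density => //; case: Ltheta.
- by apply/measurable_EFinP; apply: measurable_density => //; case: vt.
- by apply: filterS (Loo01_clamp Ltheta) => x h Omx; rewrite /= /density/= -h.
Qed.

Lemma measurable_opt_frac mu : measurable_fun setT (opt_frac c mu : RR -> RR).
Proof.
rewrite /opt_frac; case: (mu == 0); first exact: measurable_cst.
rewrite /theta_of; apply: measurable_fun_ifT.
- exact: measurable_fun_ltr.
- exact: measurable_cst.
- apply: measurable_fun_ifT; [exact: measurable_fun_ler| |exact: measurable_cst].
  by apply: measurable_funM => //; apply: measurable_funB => //; exact: measurable_funM.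
Qed.

Definition opt_frac_field mu u (x : 'rV[R]_N) : R := opt_frac c mu (enorm (u.2 x)).

Lemma vol_frac_opt_frac mu u : 0 <= mu -> measurable_wfun Om u ->
  vol_frac (opt_frac_field mu u).
Proof.
move=> mu0 mu_; split; last by move=> x; apply: opt_frac01 => //; exact: enorm_ge0.
by apply: (measurableT_comp (measurable_opt_frac mu)); exact: measurable_enorm_snd.
Qed.

Lemma integrable_lagrangian mu u theta : W1p Om p u -> vol_frac theta ->
  lam.-integrable Om (EFin \o (fun x => lagrangian p c mu (enorm (u.2 x)) (theta x))).
Proof.
move=> Wu vt.
exact: (integrableD mOm (integrableZl mOm p^-1 (integrable_density Wu vt))
  (integrableZl mOm (multiplier p c mu) (integrable_vol_frac vt))).
Qed.

Lemma Rintegral_lagrangian mu u theta : W1p Om p u -> vol_frac theta ->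
  \int[lam]_(x in Om) lagrangian p c mu (enorm (u.2 x)) (theta x) =
  p^-1 * \int[lam]_(x in Om) density u theta x +
  multiplier p c mu * \int[lam]_(x in Om) theta x.
Proof.
move=> Wu vt; have d := integrable_density Wu vt; have i := integrable_vol_frac vt.
rewrite -!RintegralZl// -RintegralD//.
  exact: (integrableZl mOm p^-1 d).
exact: (integrableZl mOm (multiplier p c mu) i).
Qed.

Lemma Fmu_optimal mu u x : 0 <= mu ->
  Fmu p c mu (enorm (u.2 x)) = lagrangian p c mu (enorm (u.2 x)) (opt_frac_field mu u x).
Proof. by move=> mu0; rewrite FmuE// enorm_ge0. Qed.

Lemma Rintegral_Fmu mu u : 0 <= mu -> W1p Om p u ->
  \int[lam]_(x in Om) Fmu p c mu (enorm (u.2 x)) =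
  p^-1 * \int[lam]_(x in Om) density u (opt_frac_field mu u) x +
  multiplier p c mu * \int[lam]_(x in Om) opt_frac_field mu u x.
Proof.
move=> mu0 Wu; rewrite -Rintegral_lagrangian//.
  by apply: eq_Rintegral => x _; exact: Fmu_optimal.
by apply: vol_frac_opt_frac => //; exact: W1p_measurable Wu.
Qed.

Lemma integrable_Fmu mu u : 0 <= mu -> W1p Om p u ->
  lam.-integrable Om (EFin \o (fun x => Fmu p c mu (enorm (u.2 x)))).
Proof.
move=> mu0 Wu.
rewrite (_ : (fun x => _) = (fun x => lagrangian p c mu (enorm (u.2 x)) (opt_frac_field mu u x))).
  apply: integrable_lagrangian => //.
  by apply: vol_frac_opt_frac => //; exact: W1p_measurable Wu.
by apply/funext => x; exact: Fmu_optimal.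
Qed.

Lemma F_energyE (f : wfun R N -> R) mu u : 0 <= mu -> W1p Om p u ->
  F_energy Om f (Fmu p c mu) u =
  (\int[lam]_(x in Om) Fmu p c mu (enorm (u.2 x)) - f u)%:E.
Proof.
by move=> mu0 Wu; rewrite EFinB -EFin_Rintegral//; exact: integrable_Fmu.
Qed.

Lemma Rintegral_Fmu_le mu u theta : 0 <= mu -> W1p Om p u -> vol_frac theta ->
  \int[lam]_(x in Om) Fmu p c mu (enorm (u.2 x)) <=
  p^-1 * \int[lam]_(x in Om) density u theta x +
  multiplier p c mu * \int[lam]_(x in Om) theta x.
Proof.
move=> mu0 Wu vt; rewrite -Rintegral_lagrangian//; apply: le_Rintegral => //.
- exact: integrable_Fmu.
- exact: integrable_lagrangian.
- by move=> x _; rewrite FmuE ?enorm_ge0// Fmin_le ?enorm_ge0//; case: vt.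
Qed.

(** The Lagrangian dominates its minimum pointwise, so the two integrals agree
    only if the integrands agree almost everywhere. *)
Lemma Rintegral_Fmu_eq mu u theta : 0 <= mu -> W1p Om p u -> vol_frac theta ->
  (p^-1 * \int[lam]_(x in Om) density u theta x +
   multiplier p c mu * \int[lam]_(x in Om) theta x <=
   \int[lam]_(x in Om) Fmu p c mu (enorm (u.2 x))) <->
  {ae lam, forall x, Om x ->
    lagrangian p c mu (enorm (u.2 x)) (theta x) = Fmu p c mu (enorm (u.2 x))}.
Proof.
move=> mu0 Wu vt; rewrite -Rintegral_lagrangian//.
have iL := integrable_lagrangian mu Wu vt; have iF := integrable_Fmu mu0 Wu.
pose d x := lagrangian p c mu (enorm (u.2 x)) (theta x) - Fmu p c mu (enorm (u.2 x)).
have d0 x : 0 <= d x.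
  by rewrite subr_ge0 FmuE ?enorm_ge0// Fmin_le ?enorm_ge0//; case: vt.
have id : lam.-integrable Om (EFin \o d) by exact: (integrableB mOm iL iF).
have md := measurable_int _ id.
have eqd : \int[lam]_(x in Om) lagrangian p c mu (enorm (u.2 x)) (theta x) -
    \int[lam]_(x in Om) Fmu p c mu (enorm (u.2 x)) = \int[lam]_(x in Om) d x.
  by rewrite -RintegralB.
have ned : (\int[lam]_(x in Om) `|(d x)%:E| = (\int[lam]_(x in Om) d x)%:E)%E.
  by rewrite -EFin_Rintegral//; apply: eq_integral => x _; rewrite gee0_abs// lee_fin.
have [ae1 ae2] := ae_eq_integral_abs lam mOm md.
rewrite -subr_le0 eqd; split => [dle0|h].
  have : ae_eq lam Om (EFin \o d) (cst 0%E).
    apply: ae1; rewrite ned; congr EFin; apply/eqP; rewrite eq_le dle0/=.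
    by apply: Rintegral_ge0.
  apply: filterS => x /[apply] -[] /eqP; rewrite subr_eq0 => /eqP//.
have : (\int[lam]_(x in Om) `|(d x)%:E| = 0)%E.
  by apply: ae2; apply: filterS h => x /[apply] h; rewrite /= /d h subrr.
by rewrite ned => -[->].
Qed.

Lemma vol_frac_mix t theta tau : 0 <= t <= 1 -> vol_frac theta -> vol_frac tau ->
  vol_frac (fun x => t * theta x + (1 - t) * tau x).
Proof.
move=> /andP[t0 t1] [mtheta ht] [mtau ht']; split.
  by apply: measurable_funD; exact: measurable_funM.
move=> x; have /andP[a0 a1] := ht x; have /andP[b0 b1] := ht' x.
have t1' : 0 <= 1 - t by rewrite subr_ge0.
rewrite addr_ge0 ?mulr_ge0//=.
have : t * theta x <= t * 1 by rewrite ler_wpM2l.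
have : (1 - t) * tau x <= (1 - t) * 1 by rewrite ler_wpM2l.
lra.
Qed.

(** Convexity of the energy in the pair: joint convexity of the perspective,
    with the triangle inequality inside the increasing power. *)
Lemma Rintegral_density_mix t u v theta tau : 0 <= t <= 1 -> W1p Om p u -> W1p Om p v ->
  vol_frac theta -> vol_frac tau ->
  \int[lam]_(x in Om) density (wmix t u v) (fun x => t * theta x + (1 - t) * tau x) x <=
  t * \int[lam]_(x in Om) density u theta x + (1 - t) * \int[lam]_(x in Om) density v tau x.
Proof.
move=> t01 Wu Wv vt vt'; have /andP[t0 t1] := t01.
have t1' : 0 <= 1 - t by rewrite subr_ge0.
have i1 := integrable_density Wu vt; have i2 := integrable_density Wv vt'.
rewrite -(Rintegral_mix mOm t i1 i2); apply: le_Rintegral => //.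
- by apply: integrable_density; [exact: W1p_mix|exact: vol_frac_mix].
- exact: (integrableD mOm (integrableZl mOm t i1) (integrableZl mOm (1 - t) i2)).
move=> x _; have /andP[a0 _] := vt.2 x; have /andP[b0 _] := vt'.2 x.
have den (s : R) : 0 <= s -> 0 < 1 + c * s by move=> s0; rewrite ltr_pwDl// mulr_ge0// ltW.
have := persp_convex p1 t01 (enorm_ge0 (u.2 x)) (enorm_ge0 (v.2 x)) (den _ a0) (den _ b0).
apply: le_trans; rewrite /density.
have -> : t * (1 + c * theta x) + (1 - t) * (1 + c * tau x) =
    1 + c * (t * theta x + (1 - t) * tau x) by ring.
rewrite ler_wpM2r ?invr_ge0 ?powR_ge0//.
rewrite ge0_ler_powR// ?nnegrE ?addr_ge0 ?mulr_ge0 ?enorm_ge0//.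
  by rewrite ltW// (lt_trans ltr01).
exact: enorm_convex.
Qed.

End energies.

(** * Lagrange multipliers for one convex constraint *)

Section convex_multiplier.
Context {R : realType} {T : Type}.
Variables (X : set T) (J G : T -> R).

(** Lagrange multiplier under Slater's condition [G y0 < 0].  If [G x > 0 > G y],
    the mixture of [x] and [y] for which the constraint is active is admissible,
    and minimality there says
    [(J x0 - J x) / G x <= (J y - J x0) / (- G y)].
    The supremum of the left-hand sides, or 0 if it is smaller, is a multiplier;
    [y0] shows that it is finite. *)
Lemma convex_multiplier (x0 y0 : T) :
  (forall x y t, X x -> X y -> 0 <= t <= 1 ->
    exists z, [/\ X z, J z <= t * J x + (1 - t) * J y & G z <= t * G x + (1 - t) * G y]) ->
  (forall x, X x -> G x <= 0 -> J x0 <= J x) ->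
  X y0 -> G y0 < 0 ->
  exists2 l, 0 <= l & forall x, X x -> J x0 <= J x + l * G x.
Proof.
move=> mix x0min Xy0 Gy0.
pose S : set R := [set 0] `|` [set r | exists x, [/\ X x, 0 < G x & r = (J x0 - J x) / G x]].
have bound y : X y -> G y < 0 -> ubound S ((J y - J x0) / (- G y)).
  move=> Xy Gy r [->|[x [Xx Gx ->]]].
    by rewrite divr_ge0 ?oppr_ge0 ?(ltW Gy)// subr_ge0 x0min// ltW.
  have D0 : 0 < G x - G y by rewrite subr_gt0 (lt_trans Gy).
  (* the weight at which the constraint is active for the mixture *)
  pose t := - G y / (G x - G y).
  have t01 : 0 <= t <= 1.
    rewrite divr_ge0 ?oppr_ge0 ?(ltW Gy) ?(ltW D0)//=.
    by rewrite ler_pdivrMr// mul1r lerDr ltW.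
  have [z [Xz Jz Gz]] := mix x y t Xx Xy t01.
  have Gz0 : G z <= 0.
    apply: le_trans Gz _; apply: le_of_eq; rewrite /t; field; rewrite gt_eqF//.
  have := le_trans (x0min z Xz Gz0) Jz.
  rewrite -(ler_pM2r D0).
  have -> : (t * J x + (1 - t) * J y) * (G x - G y) = - G y * J x + G x * J y.
    by rewrite /t; field; rewrite gt_eqF.
  move=> h; rewrite ler_pdivrMr// mulrAC ler_pdivlMr ?oppr_gt0//.
  lra.
have S0 : S !=set0 by exists 0; left.
have Sub : has_sup S by split => //; exists ((J y0 - J x0) / (- G y0)); exact: bound.
exists (sup S); first by apply: ub_le_sup; [case: Sub|left].
move=> x Xx; have [Gx|Gx|Gx] := ltgtP (G x) 0.
- have : sup S <= (J x - J x0) / (- G x) by apply: ge_sup => //; exact: bound.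
  rewrite ler_pdivlMr ?oppr_gt0//; lra.
- have : (J x0 - J x) / G x <= sup S by apply: ub_le_sup; [case: Sub|right; exists x].
  rewrite ler_pdivrMr//; lra.
- by rewrite Gx mulr0 addr0 x0min// Gx.
Qed.

End convex_multiplier.

(** * Characterization of the solutions *)

Section characterization.
Context {R : realType} {N : nat}.
Variables (Om : set 'rV[R]_N) (p c kappa : R) (f : wfun R N -> R).
Hypotheses (mOm : measurable Om) (finOm : (lebesgue_rV N Om < +oo)%E).
Hypotheses (p1 : 1 < p) (c0 : 0 < c) (kappa0 : 0 < kappa) (hf : W1p0_dual Om p f).
Notation lam := (lebesgue_rV N).
Implicit Types (u v : wfun R N) (theta : 'rV[R]_N -> R).

Lemma affine_mix (q A B C t a b : R) : q * A <= q * (t * B + (1 - t) * C) ->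
  q * A - (t * a + (1 - t) * b) <= t * (q * B - a) + (1 - t) * (q * C - b).
Proof. by move=> h; apply: le_trans (lerB h (lexx _)) _; apply: le_of_eq; ring. Qed.

Lemma affine_shift (B C t k : R) :
  t * B + (1 - t) * C - k = t * (B - k) + (1 - t) * (C - k).
Proof. ring. Qed.

(** Linearity is only given for combinations [a *: u + v], so [(1 - t) *: v] has
    first to be seen in the space, as the mixture of [v] and 0. *)
Lemma dual_mix t u v : 0 <= t <= 1 -> W1p0 Om p u -> W1p0 Om p v ->
  f (wmix t u v) = t * f u + (1 - t) * f v.
Proof.
move=> t01 Wu Wv; have lin := hf.1.
have W0 := W1p0_0 p1 Wu.
have f00 : f 0 = 0.
  have := lin 1 _ _ W0 W0; rewrite scale1r addr0 mul1r => h.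
  by apply: (@addIr _ (f 0)); rewrite add0r -h.
have Wv1 : W1p0 Om p ((1 - t) *: v).
  have t01' : 0 <= 1 - t <= 1 by case/andP: t01 => *; lra.
  have := W1p0_mix mOm finOm p1 t01' Wv W0.
  by rewrite /wmix scaler0 addr0.
rewrite /wmix (lin _ _ _ Wu Wv1); congr (_ + _).
by have := lin (1 - t) _ _ Wv W0; rewrite addr0 f00 addr0.
Qed.

Let energy (ut : wfun R N * ('rV[R]_N -> R)) : R :=
  p^-1 * \int[lam]_(x in Om) density p c ut.1 ut.2 x - f ut.1.

Let excess (ut : wfun R N * ('rV[R]_N -> R)) : R :=
  \int[lam]_(x in Om) ut.2 x - kappa.

Let pairs : set (wfun R N * ('rV[R]_N -> R)) :=
  [set ut | W1p0 Om p ut.1 /\ vol_frac Om ut.2].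

Lemma energy_mix x y t : pairs x -> pairs y -> 0 <= t <= 1 ->
  exists z, [/\ pairs z, energy z <= t * energy x + (1 - t) * energy y &
    excess z <= t * excess x + (1 - t) * excess y].
Proof.
move=> [Wu vt] [Wv vt'] t01.
exists (wmix t x.1 y.1, fun s => t * x.2 s + (1 - t) * y.2 s); split.
- by split; [exact: W1p0_mix|exact: vol_frac_mix].
- have h := Rintegral_density_mix mOm finOm p1 c0 t01 Wu.1 Wv.1 vt vt'.
  have pi0 : 0 <= p^-1 by rewrite invr_ge0 ltW// (lt_trans ltr01).
  have {}h := ler_wpM2l pi0 h.
  rewrite /energy/= (dual_mix t01 Wu Wv).
  exact: (@affine_mix _ _ _ _ _ (f x.1) (f y.1) h).
- have i1 := integrable_vol_frac mOm finOm vt; have i2 := integrable_vol_frac mOm finOm vt'.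
  by rewrite /excess/= (Rintegral_mix mOm t i1 i2) affine_shift lexx.
Qed.

Lemma admissible_of_pairs ut : pairs ut -> excess ut <= 0 -> R_admissible Om p kappa ut.
Proof.
case: ut => u theta [/= Wu vt]; rewrite /excess/= subr_le0 => Ik; split => //=.
  exact: vol_frac_Loo01.
by rewrite EFin_Rintegral ?lee_fin//; exact: integrable_vol_frac.
Qed.

Lemma R_energy_pairs ut : pairs ut -> R_energy Om p c f ut = (energy ut)%:E.
Proof.
case: ut => u theta [/= Wu vt]; have Lt := vol_frac_Loo01 vt.
have e := R_energyE mOm p1 c0 f Wu.1 Lt.
have ct : clamp01 \o theta = theta.
  by apply/funext => x; exact: clamp01_id (vt.2 x).
by rewrite ct in e; exact: e.
Qed.

(** The zero fraction has integral [0 < kappa], which is Slater's condition.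
    Every nonnegative number is the multiplier of some [mu], so the threshold
    [mu] parametrizes the multipliers. *)
Lemma solution_multiplier u theta : W1p0 Om p u -> Loo01 Om theta ->
  R_solution Om p c kappa f u theta ->
  exists2 mu, 0 <= mu &
    forall v tau, W1p0 Om p v -> vol_frac Om tau ->
      energy (u, clamp01 \o theta) <= energy (v, tau) +
        multiplier p c mu * excess (v, tau).
Proof.
move=> Wu Lt [[_ _ /= Ik] umin]; have vt := Loo01_vol_frac Lt.
have zero_frac : vol_frac Om (fun=> 0 : R).
  by split; [exact: measurable_cst|move=> x; rewrite lexx ler01].
have [|||l l0 hl] := @convex_multiplier R _ pairs energy excess (u, clamp01 \o theta) (u, fun=> 0) energy_mix.
- move=> ut Xut Gut; have := umin ut (admissible_of_pairs Xut Gut).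
  by rewrite (R_energy_pairs Xut) (R_energyE mOm p1 c0 f Wu.1 Lt) lee_fin.
- by split.
- by rewrite /excess/= Rintegral_cst// mul0r sub0r oppr_lt0.
have [mu mu0 mul] := multiplier_surj p1 c0 l0.
by exists mu => // v tau Wv vtau; rewrite mul; apply: hl.
Qed.

Lemma excess_clamp theta u : Loo01 Om theta ->
  (\int[lam]_(x in Om) (theta x)%:E = (excess (u, clamp01 \o theta) + kappa)%:E)%E.
Proof. by move=> Lt; rewrite integral_Loo01// /excess/= subrK. Qed.

(** For a solution, testing the multiplier inequality with the pair itself gives
    complementary slackness, and testing it with [v] and its optimal fraction
    bounds the Lagrangian at the solution by the energy of [v] for [Fmu].  With
    [v = u] this forces equality in the pointwise minimum, hence determines the
    fraction; with [v] arbitrary it gives minimality of [u].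

    Conversely the prescribed fraction attains the pointwise minimum and makes
    the constraint term vanish, so the energy of any admissible pair is bounded
    below by that of [(u, theta)]. *)
Lemma relaxed_solution_iff u theta : W1p0 Om p u -> Loo01 Om theta ->
  (R_solution Om p c kappa f u theta <->
      exists mu : R,
        [/\ 0 <= mu,
            is_minimizer (W1p0 Om p) (F_energy Om f (Fmu p c mu)) u,
            mu = 0 ->
              {ae lebesgue_rV N, forall x, Om x ->
                 0 < enorm (u.2 x) -> theta x = 1} /\
              (\int[lebesgue_rV N]_(x in Om) (theta x)%:E <= kappa%:E)%E &
            0 < mu ->
              {ae lebesgue_rV N, forall x, Om x ->
                 theta x = theta_of c mu (enorm (u.2 x))} /\
              (\int[lebesgue_rV N]_(x in Om) (theta x)%:E = kappa%:E)%E]).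
Proof.
move=> Wu Lt; have vt := Loo01_vol_frac Lt; have aec := Loo01_clamp Lt.
have iE := excess_clamp u Lt.
split=> [sol|[mu [mu0 umin h0 hpos]]].
  have [mu mu0 hmu] := solution_multiplier Wu Lt sol.
  have ex0 : excess (u, clamp01 \o theta) <= 0.
    by case: sol => -[_ _ /=]; rewrite iE lee_fin gerDr.
  have l0 := multiplier_ge0 mu p1 c0.
  have compl : multiplier p c mu * excess (u, clamp01 \o theta) = 0.
    apply/eqP; rewrite eq_le mulr_ge0_le0//=.
    by have := hmu u _ Wu vt; rewrite lerDl.
  have opt v : W1p0 Om p v ->
      p^-1 * \int[lam]_(x in Om) density p c u (clamp01 \o theta) x +
      multiplier p c mu * \int[lam]_(x in Om) (clamp01 (theta x)) - f u <=
      \int[lam]_(x in Om) Fmu p c mu (enorm (v.2 x)) - f v.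
    move=> Wv; rewrite (Rintegral_Fmu mOm finOm p1 c0 mu0 Wv.1).
    have := hmu v _ Wv (vol_frac_opt_frac c0 mu0 (W1p_measurable Wv.1)).
    move: compl; rewrite /energy /excess/=.
    move: (\int[lam]_(x in Om) density _ _ _ _ _) (\int[lam]_(x in Om) density _ _ _ _ _) => A B.
    move: (\int[lam]_(x in Om) _) (\int[lam]_(x in Om) _) => C D.
    rewrite !mulrBr; lra.
  have aeF : {ae lam, forall x, Om x ->
      lagrangian p c mu (enorm (u.2 x)) (clamp01 (theta x)) = Fmu p c mu (enorm (u.2 x))}.
    apply/(Rintegral_Fmu_eq mOm finOm p1 c0 mu0 Wu.1 vt).
    by have := opt u Wu; rewrite lerD2r.
  have aet : {ae lam, forall x, Om x -> 0 < enorm (u.2 x) \/ 0 < mu ->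
      theta x = opt_frac c mu (enorm (u.2 x))}.
    apply: filterS2 aec aeF => x hc hF Omx pos; rewrite hc//.
    apply/eqP; apply: contraPT (hF Omx) => ne.
    have := Fmin_lt p1 c0 mu0 (enorm_ge0 (u.2 x)) (clamp01_itv (theta x)) pos ne.
    by rewrite FmuE ?enorm_ge0// => lt eq; rewrite eq ltxx in lt.
  exists mu; split=> //.
  - split; first exact: Wu.
    move=> v Wv; rewrite (F_energyE mOm finOm p1 c0 f mu0 Wu.1) (F_energyE mOm finOm p1 c0 f mu0 Wv.1).
    rewrite lee_fin; apply: le_trans (opt v Wv); rewrite lerD2r.
    exact: (Rintegral_Fmu_le mOm finOm p1 c0 mu0 Wu.1 vt).
  - move=> mu00; split; last by rewrite iE lee_fin gerDr.
    apply: filterS aet => x h Omx s0; rewrite h//; last by left.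
    by rewrite /opt_frac mu00 eqxx.
  - move=> mupos; split.
      apply: filterS aet => x h Omx; rewrite h//; last by right.
      by rewrite /opt_frac gt_eqF.
    rewrite iE; congr EFin; apply/eqP; rewrite -subr_eq0 addrK.
    move/eqP: compl; rewrite mulf_eq0 => /orP[|//].
    by rewrite gt_eqF// multiplier_gt0.
have l0 := multiplier_ge0 mu p1 c0.
have [ex0 compl] : excess (u, clamp01 \o theta) <= 0 /\
    multiplier p c mu * excess (u, clamp01 \o theta) = 0.
  move: mu0; rewrite le_eqVlt => /predU1P[mu00|mupos].
    have [_] := h0 (esym mu00); rewrite iE lee_fin gerDr => ->.
    by rewrite -mu00 multiplier0// mul0r.
  have [_] := hpos mupos; rewrite iE => -[] /eqP.
  by rewrite -subr_eq0 addrK => /eqP ->; rewrite mulr0.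
have aeF : {ae lam, forall x, Om x ->
    lagrangian p c mu (enorm (u.2 x)) (clamp01 (theta x)) = Fmu p c mu (enorm (u.2 x))}.
  move: mu0; rewrite le_eqVlt => /predU1P[mu00|mupos].
    have [ae1 _] := h0 (esym mu00).
    apply: filterS2 aec ae1 => x hc h1 Omx.
    rewrite FmuE ?enorm_ge0//; last by rewrite -mu00.
    rewrite -hc// /Fmin /opt_frac -mu00 eqxx.
    have [s0|s0] := eqVneq (enorm (u.2 x)) 0.
      rewrite s0 /lagrangian multiplier0// !mul0r powR0 ?mul0r//.
      by rewrite gt_eqF// (lt_trans ltr01).
    by rewrite h1// lt0r s0 enorm_ge0.
  have [ae1 _] := hpos mupos.
  apply: filterS2 aec ae1 => x hc h1 Omx.
  rewrite FmuE ?enorm_ge0 ?(ltW mupos)//.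
  by rewrite -hc// h1// /Fmin /opt_frac gt_eqF.
have Jle := (Rintegral_Fmu_eq mOm finOm p1 c0 mu0 Wu.1 vt).2 aeF.
split; first by split; [exact: Wu|exact: Lt|rewrite /= iE lee_fin gerDr].
move=> [v tau] [/= Wv Ltau Ik]; have vtau := Loo01_vol_frac Ltau.
rewrite (R_energyE mOm p1 c0 f Wu.1 Lt) (R_energyE mOm p1 c0 f Wv.1 Ltau).
rewrite lee_fin.
have := umin.2 v Wv.
rewrite (F_energyE mOm finOm p1 c0 f mu0 Wu.1) (F_energyE mOm finOm p1 c0 f mu0 Wv.1).
rewrite lee_fin.
have := Rintegral_Fmu_le mOm finOm p1 c0 mu0 Wv.1 vtau.
have exv : multiplier p c mu * excess (v, clamp01 \o tau) <= 0.
  rewrite mulr_ge0_le0//; move: Ik; rewrite (excess_clamp v Ltau) lee_fin.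
  by rewrite gerDr.
move: exv compl Jle; rewrite /excess/= !mulrBr.
move: (\int[lam]_(x in Om) density _ _ _ _ _) (\int[lam]_(x in Om) density _ _ _ _ _) => A B.
move: (\int[lam]_(x in Om) clamp01 (theta x)) (\int[lam]_(x in Om) clamp01 (tau x)) => C D.
move: (\int[lam]_(x in Om) _) (\int[lam]_(x in Om) _) => E F.
lra.
Qed.

End characterization.

Theorem theorem3p1 (R : realType) (N : nat) (Om : set 'rV[R]_N)
    (p alpha beta c kappa : R) (f : wfun R N -> R)
    (hN : (2 <= N)%N)
    (hOmb : bounded_set Om) (hOmo : open Om)
    (hp : 1 < p)
    (halpha : 0 < alpha) (hbeta : alpha < beta)
    (hc : c = (beta / alpha) `^ (p - 1)^-1 - 1)
    (hkappa0 : 0 < kappa) (hkappa : (kappa%:E < lebesgue_rV N Om)%E)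
    (hf : W1p0_dual Om p f) :
  (forall mu : R, 0 <= mu ->
     [/\ Fmu p c mu 0 = 0,
         C1_halfline (Fmu p c mu) (dFmu p c mu),
         W2oo_loc_pos (Fmu p c mu) &
         convex_function (`[0, +oo[%classic : set R^o) (Fmu p c mu)]) /\
  (forall (u : wfun R N) (theta : 'rV[R]_N -> R),
     W1p0 Om p u -> Loo01 Om theta ->
     (R_solution Om p c kappa f u theta <->
      exists mu : R,
        [/\ 0 <= mu,
            is_minimizer (W1p0 Om p) (F_energy Om f (Fmu p c mu)) u,
            mu = 0 ->
              {ae lebesgue_rV N, forall x, Om x ->
                 0 < enorm (u.2 x) -> theta x = 1} /\
              (\int[lebesgue_rV N]_(x in Om) (theta x)%:E <= kappa%:E)%E &
            0 < mu ->
              {ae lebesgue_rV N, forall x, Om x ->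
                 theta x = theta_of c mu (enorm (u.2 x))} /\
              (\int[lebesgue_rV N]_(x in Om) (theta x)%:E = kappa%:E)%E])).
Proof.
have c0 : 0 < c.
  have ratio1 : 1 < beta / alpha by rewrite ltr_pdivlMr// mul1r.
  rewrite hc subr_gt0.
  suff : 1 `^ (p - 1)^-1 < (beta / alpha) `^ (p - 1)^-1 by rewrite powR1.
  have r0 : 0 < beta / alpha by exact: lt_trans ratio1.
  by rewrite gt0_ltr_powR// ?nnegrE ?invr_gt0 ?subr_gt0// ltW.
have mOm := open_measurable_rV hOmo.
have finOm := bounded_lebesgue_rV_fin mOm hOmb.
split; last by move=> u theta; exact: relaxed_solution_iff.
move=> mu mu0; split.
- exact: Fmu_0.
- exact: Fmu_C1.
- exact: Fmu_W2oo.
- exact: Fmu_convex.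
Qed.
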